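(* (i) Let $C\subseteq\mathbb{R}^n$ be a closed convex cone and let $A\in\mathbb{R}^{n\times n}$ be non-singular. Then $$\delta(AC)\le\kappa(A)^{-2}\cdot\delta(C)+\left(1-\kappa(A)^{-2}\right)\cdot n.$$ (ii) Let $D\in\mathbb{R}^{p\times n}$ with $p\ge n$, let $g:\mathbb{R}^p\to\mathbb{R}\cup\{\infty\}$ be a proper convex function, let $f(x)=g(Dx)$ for $x\in\mathbb{R}^n$, and let $x_0\in\mathbb{R}^n$. Then $$\delta(f,x_0)\le\kappa(D)^{-2}\cdot\delta(g,Dx_0)+\left(1-\kappa(D)^{-2}\right)\cdot n.$$
   Context: $\|\cdot\|$ is the Euclidean norm on vectors and the operator norm on matrices, and $S^{k-1}$ is the unit sphere of $\mathbb{R}^k$. For a closed convex cone $K\subseteq\mathbb{R}^k$, $\Pi_K$ is the Euclidean projection onto $K$, and the statistical dimension is $\delta(K)=\mathbb{E}[\|\Pi_K(g)\|^2]$ with $g$ a standard Gaussian vector in $\mathbb{R}^k$. $AC=\{Ax:x\in C\}$. The descent cone of a convex function $f:\mathbb{R}^k\to\mathbb{R}\cup\{\infty\}$ at $x_0$ is $\mathcal{D}(f,x_0)=\bigcup_{\tau>0}\{y\in\mathbb{R}^k: f(x_0+\tau y)\le f(x_0)\}$, and $\delta(f,x_0):=\delta(\mathcal{D}(f,x_0))$ (the closure is taken if the descent cone is not closed). For $A\in\mathbb{R}^{p\times n}$ put $\sigma(A)=\min_{x\in S^{n-1}}\|Ax\|$ and $\kappa(A)=\min\{\|A\|/\sigma(A),\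 \|A\|/\sigma(A^T)\}$, where a quotient with zero denominator is $+\infty$ and $(+\infty)^{-2}=0$. *)

(* Defs.v *)
From HB Require Import structures.
From mathcomp Require Import all_boot all_order all_algebra.
From mathcomp Require Import all_classical all_reals all_analysis.

Set Implicit Arguments.
Unset Strict Implicit.
Unset Printing Implicit Defensive.

Import Order.TTheory GRing.Theory Num.Theory.
Import numFieldNormedType.Exports.

Local Open Scope classical_set_scope.
Local Open Scope ring_scope.

Section EuclideanNorm.
Context {R : realType}.

(* The library norm [`|x|] on matrices is the entrywise maximum. *)
Definition enorm k (x : 'cV[R]_k) : R := Num.sqrt (\sum_(i < k) x i 0 ^+ 2).

Definition esphere k : set 'cV[R]_k := [set x | enorm x = 1].

Definition opnorm p n (A : 'M[R]_(p, n)) : R :=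
  sup [set enorm (A *m x) | x in [set x : 'cV[R]_n | enorm x <= 1]].

(* For n > 0 the infimum is attained, by compactness of the sphere; for n = 0 the
   sphere is empty and the value is 0. *)
Definition sigma_min p n (A : 'M[R]_(p, n)) : R :=
  inf [set enorm (A *m x) | x in @esphere n].

(* Not the library division of extended reals, for which 0 / 0 = 0. *)
Definition quot_infty (a b : R) : \bar R :=
  if b == 0 then +oo%E else (a / b)%:E.

Definition kappa p n (A : 'M[R]_(p, n)) : \bar R :=
  Order.min (quot_infty (opnorm A) (sigma_min A))
            (quot_infty (opnorm A) (sigma_min A^T)).

End EuclideanNorm.

Section GaussianMeasure.
Context {R : realType}.

Definition tcons k (xt : measurableTypeR R * k.-tuple (measurableTypeR R)) :
    k.+1.-tuple (measurableTypeR R) :=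
  [the k.+1.-tuple _ of xt.1 :: xt.2].

Lemma measurable_tcons k : measurable_fun setT (@tcons k).
Proof. exact: measurable_cons. Qed.

HB.instance Definition _ k :=
  isMeasurableFun.Build _ _ _ _ (@tcons k) (@measurable_tcons k).

(* k-fold product of the standard normal law, carried by tuples, which (unlike
   matrices) have a measurable structure in the library. *)
Fixpoint gaussian (k : nat) : probability (k.-tuple (measurableTypeR R)) R :=
  match k with
  | 0 => \d_([tuple] : 0.-tuple (measurableTypeR R))
  | k'.+1 =>
      distribution (normal_prob (0 : R) (1 : R) \x gaussian k')%E (@tcons k')
  end.

Definition col_of_tuple k (t : k.-tuple R) : 'cV[R]_k := \col_i tnth t i.

End GaussianMeasure.

Section Cones.
Context {R : realType}.

Definition closed_convex_cone k (K : set 'cV[R]_k) : Prop :=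
  [/\ K !=set0, closed K, convex_set K
    & forall (a : R) (x : 'cV[R]_k), 0 <= a -> K x -> K (a *: x)].

(* When K is non-empty, closed and convex, there is exactly one nearest point. *)
Definition eproj k (K : set 'cV[R]_k) (x : 'cV[R]_k) : 'cV[R]_k :=
  get [set y | K y /\ forall z, K z -> enorm (x - y) <= enorm (x - z)].

Definition stat_dim k (K : set 'cV[R]_k) : \bar R :=
  ('E_(gaussian k)[fun t => (enorm (eproj K (col_of_tuple t)) ^+ 2)%R])%E.

Definition mximage p n (A : 'M[R]_(p, n)) (C : set 'cV[R]_n) : set 'cV[R]_p :=
  [set A *m x | x in C].

(* A function to R U {oo} is a \bar R-valued function avoiding -oo.  In the
   library 0 * +oo = 0, so the endpoints t = 0, 1 are harmless. *)
Definition proper_convex k (f : 'cV[R]_k -> \bar R) : Prop :=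
  [/\ forall x, f x != -oo%E,
      exists x, f x != +oo%E
    & forall (x y : 'cV[R]_k) (t : R), 0 <= t <= 1 ->
        (f (t *: x + (1 - t) *: y)%R <= t%:E * f x + (1 - t)%:E * f y)%E].

Definition descent_cone k (f : 'cV[R]_k -> \bar R) (x0 : 'cV[R]_k) :
    set 'cV[R]_k :=
  \bigcup_(tau in [set tau : R | 0 < tau])
    [set y | (f (x0 + tau *: y)%R <= f x0)%E].

Definition stat_dim_at k (f : 'cV[R]_k -> \bar R) (x0 : 'cV[R]_k) : \bar R :=
  stat_dim (closure (descent_cone f x0)).

End Cones.

(* Main.v *)
Require Import Defs.
From mathcomp Require Import all_boot all_order all_algebra.
From mathcomp Require Import ring lra.
From mathcomp Require Import all_classical all_reals all_analysis.
From mathcomp Require Import measurable_realfun.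
Set Implicit Arguments.
Unset Strict Implicit.
Unset Printing Implicit Defensive.
Import Order.TTheory GRing.Theory Num.Theory.
Import numFieldNormedType.Exports.
Local Open Scope classical_set_scope.
Local Open Scope ring_scope.

(** The statistical dimension is a defect of distance.  For a closed cone [K],
    Pythagoras gives [|proj_K x|^2 = |x|^2 - d_K(x)^2], where [d_K] is the distance
    to [K] ([nsq_eproj]), so that [delta(K) = E|g|^2 - E d_K(g)^2] ([stat_dimE]).
    Both inequalities thus become lower bounds on a mean squared distance, to be
    combined with [E|g|^2 <= n] ([gauss_mean_nsq]).

    For (i) the bound is [E d_C(g)^2 <= kappa^2 E d_AC(g)^2].  It rests on a
    comparison principle ([gaussian_comparison]): if [B] is a contraction and [psi]
    is convex and nonnegative, then [E psi(B g) <= E psi(g)], since [B] is an average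
    of orthogonal matrices and the law of [g] is invariant under these.  The principle
    is applied to [B = A / |A|] and to [psi(y) = d_C(A^-1 y)^2]; homogeneity of the
    cone takes the factor [|A|^2] out, and [sigma(A)^2 psi(y) <= d_AC(y)^2]
    ([mean_sqdist_mximage_le]).  A lower bound on [A^T] gives the same lower bound on
    [A] for square matrices ([mulmx_lb_tr]), which accounts for the minimum in
    [kappa].

    For (ii), the descent cone of [f = g o D] is the preimage [C] under [D] of the
    descent cone [K] of [g].  If [D] is not injective, [kappa(D)] is infinite and the
    claim is [delta <= n].  Otherwise [D C] is contained in [K], and after an
    orthogonal change of coordinates sending the range of [D] to the first [n]
    coordinates, [d_DC] splits into a distance inside the range and the norm of the
    [p - n] other coordinates; inside the range [D] is an invertible matrix, to which
    the argument of (i) applies through its inverse ([mean_sqdist_preimage]).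

    Orthogonal invariance of the iterated product law is obtained for Givens rotations
    ([gaussian_symmetry_rot]), from two one-variable changes of variable; products of
    such rotations suffice for the singular value and QR reductions that are used
    ([nsq_contraction_split], [reduce_columns]). *)

(** * Squared norms and squared distances *)

Section SquaredNorm.
Context {R : realType}.
Implicit Types (k m n p : nat).

Definition nsq k (x : 'cV[R]_k) : R := \sum_(i < k) x i 0 ^+ 2.

Lemma nsq_ge0 k (x : 'cV[R]_k) : 0 <= nsq x.
Proof. by apply: sumr_ge0 => i _; exact: sqr_ge0. Qed.

Lemma enormE k (x : 'cV[R]_k) : enorm x = Num.sqrt (nsq x).
Proof. by []. Qed.

Lemma enorm_ge0 k (x : 'cV[R]_k) : 0 <= enorm x.
Proof. exact: sqrtr_ge0. Qed.

Lemma sqr_enorm k (x : 'cV[R]_k) : enorm x ^+ 2 = nsq x.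
Proof. by rewrite enormE sqr_sqrtr ?nsq_ge0. Qed.

Lemma le_enorm k m (x : 'cV[R]_k) (y : 'cV[R]_m) :
  (enorm x <= enorm y) = (nsq x <= nsq y).
Proof. by rewrite !enormE ler_sqrt ?nsq_ge0. Qed.

Lemma nsq0 k : nsq (0 : 'cV[R]_k) = 0.
Proof. by rewrite /nsq big1 // => i _; rewrite mxE expr0n. Qed.

Lemma nsq_eq0 k (x : 'cV[R]_k) : (nsq x == 0) = (x == 0).
Proof.
apply/eqP/eqP => [x0|->]; last exact: nsq0.
apply/colP => i; rewrite mxE; apply/eqP; rewrite -sqrf_eq0; apply/eqP.
by apply: (psumr_eq0P _ x0) => // j _; exact: sqr_ge0.
Qed.

Lemma nsqZ k (a : R) (x : 'cV[R]_k) : nsq (a *: x) = a ^+ 2 * nsq x.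
Proof. by rewrite /nsq mulr_sumr; apply: eq_bigr => i _; rewrite mxE exprMn. Qed.

Lemma nsqN k (x : 'cV[R]_k) : nsq (- x) = nsq x.
Proof. by apply: eq_bigr => i _; rewrite mxE sqrrN. Qed.

Lemma nsq_dot k (x : 'cV[R]_k) : nsq x = (x^T *m x) 0 0.
Proof. by rewrite mxE; apply: eq_bigr => i _; rewrite mxE expr2. Qed.

Lemma nsqD k (x y : 'cV[R]_k) :
  nsq (x + y) = nsq x + 2 * (x^T *m y) 0 0 + nsq y.
Proof.
rewrite /nsq !mxE mulr_sumr -!big_split /=; apply: eq_bigr => i _.
by rewrite !mxE; ring.
Qed.

Lemma nsqB k (x y : 'cV[R]_k) :
  nsq (x - y) = nsq x - 2 * (x^T *m y) 0 0 + nsq y.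
Proof. by rewrite nsqD nsqN mulmxN mxE mulrN. Qed.

Lemma cauchy_schwarz k (x y : 'cV[R]_k) :
  (x^T *m y) 0 0 ^+ 2 <= nsq x * nsq y.
Proof.
have [->|y0] := eqVneq y 0; first by rewrite mulmx0 mxE nsq0 mulr0 expr0n.
have ny : 0 < nsq y by rewrite lt_neqAle eq_sym nsq_eq0 y0 nsq_ge0.
set d := (x^T *m y) 0 0.
(* |x - t y|^2 is least at t = d / |y|^2; scaled by |y|^2 to avoid the division *)
have := nsq_ge0 (nsq y *: x - d *: y).
have dZ : ((nsq y *: x)^T *m (d *: y)) 0 0 = nsq y * d * d.
  rewrite -scalemxAr [(_ *: x)^T]linearZ /= -scalemxAl scalerA mxE -/d.
  by rewrite [d * _]mulrC.
rewrite nsqB !nsqZ dZ => H.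
have {}H : 0 <= nsq y * (nsq x * nsq y - d ^+ 2).
  by apply: le_trans H _; rewrite le_eqVlt; apply/orP; left; apply/eqP; ring.
by rewrite -subr_ge0 -(pmulr_rge0 _ ny).
Qed.

Lemma nsq_convex k (t : R) (x y : 'cV[R]_k) : 0 <= t <= 1 ->
  nsq (t *: x + (1 - t) *: y) <= t * nsq x + (1 - t) * nsq y.
Proof.
move=> /andP[t0 t1]; rewrite /nsq !mulr_sumr -big_split /=.
apply: ler_sum => i _; rewrite !mxE -subr_ge0.
set a := x i 0; set b := y i 0.
have -> : t * a ^+ 2 + (1 - t) * b ^+ 2 - (t * a + (1 - t) * b) ^+ 2
  = t * (1 - t) * (a - b) ^+ 2 by ring.
by rewrite mulr_ge0 ?sqr_ge0 // mulr_ge0 // subr_ge0.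
Qed.

Lemma nsq_orthogonal k (Q : 'M[R]_k) (x : 'cV[R]_k) :
  Q^T *m Q = 1%:M -> nsq (Q *m x) = nsq x.
Proof. by move=> QQ; rewrite !nsq_dot trmx_mul mulmxA -(mulmxA x^T) QQ mulmx1. Qed.

Lemma nsq_col_mx k m (u : 'cV[R]_k) (v : 'cV[R]_m) :
  nsq (col_mx u v) = nsq u + nsq v.
Proof.
rewrite /nsq big_split_ord /=; congr (_ + _).
  by apply: eq_bigr => i _; rewrite col_mxEu.
by apply: eq_bigr => i _; rewrite col_mxEd.
Qed.

Lemma nsq_scalar (a : R) : nsq (a%:M : 'cV[R]_1) = a ^+ 2.
Proof. by rewrite /nsq big_ord1 mxE eqxx. Qed.

Lemma coord_le_enorm k (x : 'cV[R]_k) i : `|x i 0| <= enorm x.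
Proof.
rewrite enormE -sqrtr_sqr ler_sqrt ?nsq_ge0 // /nsq (bigD1 i) //= lerDl.
by apply: sumr_ge0 => j _; exact: sqr_ge0.
Qed.

Lemma eq_mulmx_col m n (A B : 'M[R]_(m, n)) :
  (forall x : 'cV[R]_n, A *m x = B *m x)%R -> A = B.
Proof.
move=> AB; apply/matrixP => i j.
by have /colP/(_ i) := AB (delta_mx j 0%R); rewrite -!colE !mxE.
Qed.

End SquaredNorm.

Section SquaredDistance.
Context {R : realType}.
Implicit Types (k m n p : nat).

Definition sqdist k (S : set 'cV[R]_k) (x : 'cV[R]_k) : R :=
  inf [set nsq (x - z) | z in S].

Definition convex_cone k (S : set 'cV[R]_k) : Prop :=
  [/\ S !=set0, forall x y, S x -> S y -> S (x + y)
    & forall (a : R) x, 0 <= a -> S x -> S (a *: x)].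

Lemma sqdist_le k (S : set 'cV[R]_k) x z : S z -> sqdist S x <= nsq (x - z).
Proof.
move=> Sz; apply: inf_lbound; last by exists z.
by exists 0 => _ [y _ <-]; exact: nsq_ge0.
Qed.

Lemma le_sqdist k (S : set 'cV[R]_k) x c : S !=set0 ->
  (forall z, S z -> c <= nsq (x - z)) -> c <= sqdist S x.
Proof.
move=> [z Sz] cS; apply: lb_le_inf; first by exists (nsq (x - z)); exists z.
by move=> _ [y Sy <-]; exact: cS.
Qed.

Lemma sqdist_lt k (S : set 'cV[R]_k) x c : S !=set0 -> sqdist S x < c ->
  exists2 z, S z & nsq (x - z) < c.
Proof.
move=> S0 xc; apply: contrapT => H; move: xc; rewrite ltNge => /negP; apply.
by apply: le_sqdist => // z Sz; rewrite leNgt; apply/negP => zc; apply: H; exists z.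
Qed.

Lemma sqdist_ge0 k (S : set 'cV[R]_k) x : 0 <= sqdist S x.
Proof.
have [[z Sz]|/set0P/negP/negPn/eqP S0] := pselect (S !=set0).
  by apply: le_sqdist => [|y _]; [exists z|exact: nsq_ge0].
by rewrite /sqdist S0 image_set0 inf0.
Qed.

Lemma sqdist_subset k (S T : set 'cV[R]_k) x : S !=set0 -> S `<=` T ->
  sqdist T x <= sqdist S x.
Proof. by move=> S0 ST; apply: le_sqdist => // z /ST; exact: sqdist_le. Qed.

Lemma convex_cone0 k (S : set 'cV[R]_k) : convex_cone S -> S 0.
Proof. by case=> -[x Sx] _ /(_ 0 x (lexx _) Sx); rewrite scale0r. Qed.

Lemma sqdist_le_nsq k (S : set 'cV[R]_k) x : convex_cone S ->
  sqdist S x <= nsq x.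
Proof. by move=> /convex_cone0/(sqdist_le x); rewrite subr0. Qed.

(** The distance to a convex set is convex because near-optimal points for [x] and
    [y] combine to a competitor for the segment point. *)
Lemma sqdist_convex k (S : set 'cV[R]_k) (t : R) x y :
  convex_cone S -> 0 <= t <= 1 ->
  sqdist S (t *: x + (1 - t) *: y) <= t * sqdist S x + (1 - t) * sqdist S y.
Proof.
move=> [S0 SD SZ] t01; have /andP[t0 t1] := t01.
apply/ler_addgt0Pr => e e0.
have [u Su xu] : exists2 u, S u & nsq (x - u) < sqdist S x + e.
  by apply: sqdist_lt => //; rewrite ltrDl.
have [v Sv yv] : exists2 v, S v & nsq (y - v) < sqdist S y + e.
  by apply: sqdist_lt => //; rewrite ltrDl.
have Suv : S (t *: u + (1 - t) *: v) by apply: SD; apply: SZ; rewrite ?subr_ge0.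
apply: le_trans (sqdist_le _ Suv) _.
have -> : t *: x + (1 - t) *: y - (t *: u + (1 - t) *: v)
        = t *: (x - u) + (1 - t) *: (y - v).
  by rewrite !scalerBr opprD addrACA.
apply: le_trans (nsq_convex _ _ t01) _.
have -> : t * sqdist S x + (1 - t) * sqdist S y + e =
  t * (sqdist S x + e) + (1 - t) * (sqdist S y + e) by ring.
by rewrite lerD // ler_wpM2l ?subr_ge0 // ltW.
Qed.

Lemma sqdistZ k (S : set 'cV[R]_k) (a : R) x : convex_cone S -> 0 < a ->
  sqdist S (a *: x) = a ^+ 2 * sqdist S x.
Proof.
move=> [S0 SD SZ] a0.
have le (b : R) y : 0 < b -> sqdist S (b *: y) <= b ^+ 2 * sqdist S y.
  move=> b0; rewrite -ler_pdivrMl ?exprn_gt0 //; apply: le_sqdist => // z Sz.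
  rewrite ler_pdivrMl ?exprn_gt0 // -nsqZ scalerBr.
  by apply: sqdist_le; apply: SZ => //; exact: ltW.
apply/eqP; rewrite eq_le le //= -ler_pdivlMl ?exprn_gt0 // -exprVn.
have {1}-> : x = a^-1 *: (a *: x) by rewrite scalerA mulVf ?scale1r // gt_eqF.
by rewrite le // invr_gt0.
Qed.

Lemma mximage_neq0 p n (A : 'M[R]_(p, n)) S : S !=set0 -> mximage A S !=set0.
Proof. by case=> x Sx; exists (A *m x); exists x. Qed.

Lemma convex_cone_mximage p n (A : 'M[R]_(p, n)) S :
  convex_cone S -> convex_cone (mximage A S).
Proof.
case=> S0 SD SZ; split; first exact: mximage_neq0.
  by move=> _ _ [x Sx <-] [y Sy <-]; exists (x + y); rewrite ?mulmxDr //; exact: SD.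
by move=> a _ a0 [x Sx <-]; exists (a *: x); rewrite ?scalemxAr //; exact: SZ.
Qed.

Lemma sqdist_mximage_ge p n (A : 'M[R]_(p, n)) (b : R) S x : 0 <= b ->
  S !=set0 -> (forall x, b * nsq x <= nsq (A *m x)) ->
  b * sqdist S x <= sqdist (mximage A S) (A *m x).
Proof.
move=> b0 S0 bA; apply: le_sqdist; first exact: mximage_neq0.
move=> _ [z Sz <-]; rewrite -mulmxBr; apply: le_trans (bA _).
by rewrite ler_wpM2l // sqdist_le.
Qed.

Lemma sqdist_orthogonal k (Q : 'M[R]_k) S x : S !=set0 -> Q^T *m Q = 1%:M ->
  sqdist (mximage Q S) (Q *m x) = sqdist S x.
Proof.
move=> S0 QQ; apply/eqP; rewrite eq_le; apply/andP; split; last first.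
  rewrite -[leLHS]mul1r; apply: sqdist_mximage_ge => // y.
  by rewrite mul1r nsq_orthogonal.
apply: le_sqdist => // z Sz; rewrite -(nsq_orthogonal _ QQ) mulmxBr.
by apply: sqdist_le; exists z.
Qed.

(** Pythagoras across the orthogonal splitting: the points of the set have no
    component along [v]. *)
Lemma sqdist_col_mx n m (S : set 'cV[R]_n) u (v : 'cV[R]_m) : S !=set0 ->
  sqdist [set col_mx z 0 | z in S] (col_mx u v) = sqdist S u + nsq v.
Proof.
move=> S0; have E z : nsq (col_mx u v - col_mx z 0) = nsq (u - z) + nsq v.
  by rewrite opp_col_mx add_col_mx nsq_col_mx subr0.
apply/eqP; rewrite eq_le; apply/andP; split.
  rewrite -lerBlDr; apply: le_sqdist => // z Sz; rewrite lerBlDr -E.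
  by apply: sqdist_le; exists z.
apply: le_sqdist; first by case: S0 => z Sz; exists (col_mx z 0); exists z.
by move=> _ [z Sz <-]; rewrite E lerD2r sqdist_le.
Qed.

End SquaredDistance.

(** * Continuity and compactness *)

Section MatrixTopology.
Context {R : realType}.

Lemma continuous_mx (T : topologicalType) m n (f : T -> 'M[R]_(m, n)) :
  (forall i j, continuous (fun x => f x i j)) -> continuous f.
Proof.
move=> fc x A [E nE EA].
have : \forall y \near x, forall i, forall j, E i j (f y i j).
  by apply: filter_forall => i; apply: filter_forall => j; apply: fc.
by apply: filterS => y yE; exact: EA.
Qed.

Lemma continuous_nsq k : continuous (@nsq R k).
Proof.
apply: (@continuous_big R 'I_k +%R 0 xpredT) => [|i _ x].
  exact: add_continuous.
by apply: (@continuous_comp _ _ _ (fun y : 'cV[R]_k => y i 0) (fun r => r ^+ 2));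
  [exact: coord_continuous|exact: exprn_continuous].
Qed.

Lemma continuous_mulmx m n (A : 'M[R]_(m, n)) :
  continuous (fun x : 'cV[R]_n => A *m x).
Proof.
apply: continuous_mx => i j x.
rewrite (_ : (fun y : 'cV[R]_n => _) = (fun y : 'cV[R]_n => \sum_k A i k * y k j)); last first.
  by apply/funext => y; rewrite mxE.
move: x; apply: (@continuous_big R 'I_n +%R 0 xpredT) => [|l _ x].
  exact: add_continuous.
by apply: continuousM; [exact: cst_continuous|exact: coord_continuous].
Qed.

Lemma continuous_trmx m n : continuous (@trmx R m n).
Proof.
apply: continuous_mx => i j x.
rewrite (_ : (fun y => _) = (fun y : 'M[R]_(m, n) => y j i)); last first.
  by apply/funext => y; rewrite mxE.
exact: coord_continuous.
Qed.

Lemma continuous_subl k (x : 'cV[R]_k) : continuous (fun z : 'cV[R]_k => x - z).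
Proof. by move=> z; apply: continuousB; [exact: cst_continuous|move=> ?; exact: id]. Qed.

Lemma continuous_scale k (a : R) : continuous (fun z : 'cV[R]_k => a *: z).
Proof. exact: scaler_continuous. Qed.

Lemma compact_nsq_ball k (M : R) (K : set 'cV[R]_k) : closed K ->
  compact (K `&` [set x : 'cV[R]_k | nsq x <= M]).
Proof.
move=> cK; set B := _ `&` _.
have cB : closed B.
  apply: closedI => //; rewrite (_ : [set x | _] = @nsq R k @^-1` [set y | y <= M]) //.
  by apply: closed_comp => [x _|]; [exact: continuous_nsq|exact: closed_le].
have -> : B = @trmx R 1 k @` (@trmx R 1 k @^-1` B).
  apply/seteqP; split=> [x Bx|_ [y By <-] //].
  by exists x^T; rewrite /= trmxK.
apply: continuous_compact; first exact/continuous_subspaceT/continuous_trmx.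
apply: bounded_closed_compact; last first.
  by apply: closed_comp cB => x _; exact: continuous_trmx.
exists (Num.sqrt M); split; first exact: num_real.
move=> N MN v [_ /= vM].
rewrite [leLHS]/Num.norm /= mx_normrE; apply/bigmax_leP; split=> [|[i j] _ /=].
  exact: le_trans (sqrtr_ge0 _) (ltW MN).
rewrite ord1; have := coord_le_enorm v^T j; rewrite mxE => /le_trans; apply.
by apply: le_trans (ltW MN); rewrite enormE ler_wsqrtr.
Qed.

(** Closed sets contain nearest points: after the change of variable
    [u = x - z], the competitors better than a given one form a compact set. *)
Lemma nearest_exists k (K : set 'cV[R]_k) (x : 'cV[R]_k) :
  closed K -> K !=set0 -> exists2 y, K y & forall z, K z -> nsq (x - y) <= nsq (x - z).
Proof.
move=> cK [z0 Kz0].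
pose f z := nsq (x - z).
have cf : continuous f.
  by move=> z; apply: continuous_comp; [exact: continuous_subl|exact: continuous_nsq].
pose B := (fun z => x - z) @` ((fun z => x - z) @^-1` K `&` [set u | nsq u <= f z0]).
have xK z : x - (x - z) = z by rewrite opprB addrC subrK.
have cB : compact B.
  apply: continuous_compact; first exact/continuous_subspaceT/continuous_subl.
  by apply: compact_nsq_ball; apply: closed_comp cK => z _; exact: continuous_subl.
have B0 : B z0 by exists (x - z0); [split; rewrite /= ?xK|exact: xK].
have [|y /set_mem yB ymin] := @compact_EVT_min _ R f B (ex_intro _ _ B0) cB.
  exact: continuous_subspaceT.
have [u [/= Ku _] xu] := yB.
exists y; first by rewrite -xu.
move=> z Kz; have [zz0|/ltW z0z] := leP (f z) (f z0).
  by apply: ymin; apply/mem_set; exists (x - z) => //; split => //=; rewrite xK.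
by apply: le_trans z0z; apply: ymin; exact/mem_set.
Qed.

(** The operator norm is attained; the maximizer [x] is a first right singular
    vector of [A]. *)
Lemma norm_attained m n (A : 'M[R]_(m, n.+1)) :
  exists2 x, nsq x = 1 & forall y, nsq (A *m y) <= nsq (A *m x) * nsq y.
Proof.
pose f (x : 'cV[R]_n.+1) := nsq (A *m x).
have cf : continuous f.
  by move=> z; apply: continuous_comp; [exact: continuous_mulmx|exact: continuous_nsq].
pose S := [set x : 'cV[R]_n.+1 | nsq x = 1] `&` [set x | nsq x <= 1].
have cS : compact S.
  apply: compact_nsq_ball.
  rewrite (_ : [set x | _] = @nsq R n.+1 @^-1` [set 1]) //.
  by apply: closed_comp => [x _|]; [exact: continuous_nsq|exact: closed_eq].
have S1 : S (delta_mx 0 0).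
  suff E : nsq (delta_mx 0 0 : 'cV[R]_n.+1) = 1 by split => //=; rewrite E.
  rewrite /nsq big_ord_recl big1 => [|i _]; rewrite !mxE /= ?expr0n //.
  by rewrite expr1n addr0.
have [|x /set_mem[/= x1 _] xmax] := @compact_EVT_max _ R f S (ex_intro _ _ S1) cS.
  exact: continuous_subspaceT.
exists x => // y; have [->|y0] := eqVneq y 0.
  by rewrite mulmx0 nsq0 mulr0 nsq0.
have ny : 0 < nsq y by rewrite lt_neqAle eq_sym nsq_eq0 y0 nsq_ge0.
have s0 : 0 < enorm y by rewrite enormE sqrtr_gt0.
have E : nsq ((enorm y)^-1 *: y) = 1.
  by rewrite nsqZ exprVn sqr_enorm mulVf // gt_eqF.
have := xmax ((enorm y)^-1 *: y); rewrite /f -scalemxAr nsqZ exprVn sqr_enorm.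
rewrite ler_pdivrMl // mulrC; apply; apply/mem_set; split => //=.
by rewrite E.
Qed.

Lemma sqdist_closure k (S : set 'cV[R]_k) x : S !=set0 ->
  sqdist (closure S) x = sqdist S x.
Proof.
move=> S0; apply/eqP; rewrite eq_le; apply/andP; split.
  by apply: sqdist_subset => //; exact: subset_closure.
apply: le_sqdist; first by case: S0 => z Sz; exists z; exact: subset_closure.
move=> z Sz; apply/ler_addgt0Pr => e e0.
pose f z := nsq (x - z).
have cf : continuous f.
  by move=> y; apply: continuous_comp; [exact: continuous_subl|exact: continuous_nsq].
have [|y [Sy /= fy]] := Sz (f @^-1` [set r | r < f z + e]).
  by apply: cf; apply: lt_nbhsl; rewrite ltrDl.
by apply: le_trans (sqdist_le x Sy) (ltW fy).
Qed.

Lemma convex_cone_closureZ k (S : set 'cV[R]_k) : convex_cone S ->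
  forall a x, 0 <= a -> closure S x -> closure S (a *: x).
Proof.
move=> cS a x a0 Sx A Aax; have [|y [Sy Ay]] := Sx ( *:%R a @^-1` A).
  exact: continuous_scale.
by exists (a *: y); split => //; case: cS => _ _; exact.
Qed.

(** Upper semicontinuity, as an infimum of continuous functions; this is all the
    regularity that measurability of the distance requires. *)
Lemma open_sqdist_lt k (S : set 'cV[R]_k) c : S !=set0 ->
  open [set x | sqdist S x < c].
Proof.
move=> S0.
have -> : [set x | sqdist S x < c] = \bigcup_(z in S) [set x | nsq (x - z) < c].
  apply/seteqP; split=> [x /= /(sqdist_lt S0)[z Sz xz]|x [z Sz] /= xz].
    by exists z.
  exact: le_lt_trans (sqdist_le _ Sz) xz.
apply: bigcup_open => z _.
rewrite (_ : [set x | _] = (fun x => nsq (x - z)) @^-1` [set r | r < c]) //.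
apply: open_comp; last exact: open_lt.
move=> x _; apply: continuous_comp; last exact: continuous_nsq.
by apply: continuousB; [move=> ?; exact: id|exact: cst_continuous].
Qed.

End MatrixTopology.

(** * Gaussian means as iterated integrals *)

Section GaussianExpectation.
Context {R : realType}.
Notation TR := (measurableTypeR R).
Notation N01 := (normal_prob (0 : R) (1 : R)).
Local Open Scope ereal_scope.

(** Measurability is transported along [col_of_tuple] because tuples, and not
    matrices, carry the product sigma-algebra. *)
Definition borel k (f : 'cV[R]_k -> \bar R) : Prop :=
  measurable_fun setT (fun t : k.-tuple TR => f (col_of_tuple t)).

Definition gauss_mean k (f : 'cV[R]_k -> \bar R) : \bar R :=
  \int[gaussian k]_t f (col_of_tuple t).

Lemma col_of_tuple_cons k (x : R) (t : k.-tuple R) :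
  col_of_tuple [tuple of x :: t] = col_mx x%:M (col_of_tuple t) :> 'cV[R]_(1 + k).
Proof.
apply/colP => i; rewrite !mxE; case: splitP => j ij.
  rewrite ord1 mxE (_ : i = ord0) ?tnth0 //.
  by apply/val_inj; rewrite /= ij ord1.
rewrite mxE (_ : i = lift ord0 j) ?tnthS //; exact/val_inj.
Qed.

Lemma borel_mulmx p n (A : 'M[R]_(p, n)) f :
  borel f -> borel (fun x => f (A *m x)).
Proof.
move=> bf.
pose g (t : n.-tuple TR) : p.-tuple TR := [tuple (A *m col_of_tuple t)%R i 0%R | i < p].
rewrite /borel (_ : (fun t => _) = (fun t => f (col_of_tuple t)) \o g); last first.
  apply/funext => t /=; congr f; apply/colP => i.
  by rewrite [RHS]mxE tnth_mktuple.
apply: measurableT_comp => //; apply/measurable_fun_tnthP => i.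
rewrite (_ : _ \o _ = fun t : n.-tuple TR => (\sum_j A i j * tnth t j)%R); last first.
  by apply/funext => t; rewrite /= tnth_mktuple mxE; apply: eq_bigr => j _; rewrite mxE.
apply: measurable_sum => j; apply: measurable_funM => //.
exact: measurable_tnth.
Qed.

Lemma borel_cons k (f : 'cV[R]_(1 + k) -> \bar R) : borel f ->
  measurable_fun setT
    (fun xt : TR * k.-tuple TR => f (col_mx xt.1%:M (col_of_tuple xt.2))).
Proof.
move=> bf.
rewrite (_ : (fun xt => _) = (fun t => f (col_of_tuple t)) \o @tcons R k).
  by apply: measurableT_comp => //; exact: measurable_tcons.
by apply/funext => -[x t] /=; rewrite -col_of_tuple_cons.
Qed.

Lemma borel_section k (f : 'cV[R]_(1 + k) -> \bar R) (x : R) : borel f ->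
  borel (fun y => f (col_mx x%:M y)).
Proof. by move=> /borel_cons mf; exact: (measurable_fun_pair2 x mf). Qed.

Section nonnegative.
Variables (k : nat) (f : 'cV[R]_(1 + k) -> \bar R).
Hypotheses (f0 : forall x, 0 <= f x) (bf : borel f).

Lemma measurable_gauss_mean_section :
  measurable_fun setT (fun x : TR => gauss_mean (fun y => f (col_mx x%:M y))).
Proof.
exact: (@measurable_fun_fubini_tonelli_F _ _ TR (k.-tuple TR) R (gaussian k)
  (fun xt => f (col_mx xt.1%:M (col_of_tuple xt.2))) (borel_cons bf) (fun=> f0 _)).
Qed.

(** Tonelli on the first coordinate: the recursion that carries inductions on the
    dimension. *)
Lemma gauss_meanS : @gauss_mean k.+1 f = \int[N01]_x gauss_mean (fun y => f (col_mx x%:M y)).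
Proof.
rewrite /gauss_mean [gaussian _]/= ge0_integral_distribution //.
rewrite (eq_integral (fun xt : TR * k.-tuple TR =>
  f (col_mx xt.1%:M (col_of_tuple xt.2)))); last first.
  by move=> [x t] _ /=; rewrite -col_of_tuple_cons.
by rewrite fubini_tonelli1 //; exact: borel_cons.
Qed.

End nonnegative.

Lemma eq_gauss_mean k (f g : 'cV[R]_k -> \bar R) : f =1 g -> gauss_mean f = gauss_mean g.
Proof. by move=> /funext ->. Qed.

Lemma gauss_mean_ge0 k (f : 'cV[R]_k -> \bar R) : (forall x, 0 <= f x) -> 0 <= gauss_mean f.
Proof. by move=> f0; apply: integral_ge0 => *; exact: f0. Qed.

Lemma le_gauss_mean k (f g : 'cV[R]_k -> \bar R) : (forall x, 0 <= f x) ->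
  borel f -> borel g -> (forall x, f x <= g x) -> gauss_mean f <= gauss_mean g.
Proof. by move=> f0 bf bg fg; apply: ge0_le_integral => //= t _; exact: fg. Qed.

Lemma gauss_meanZl k (c : R) (f : 'cV[R]_k -> \bar R) : (0 <= c)%R ->
  (forall x, 0 <= f x) -> borel f -> gauss_mean (fun x => c%:E * f x) = c%:E * gauss_mean f.
Proof. by move=> c0 f0 bf; rewrite /gauss_mean ge0_integralZl. Qed.

Lemma gauss_meanD k (f g : 'cV[R]_k -> \bar R) :
  (forall x, 0 <= f x) -> borel f -> (forall x, 0 <= g x) -> borel g ->
  gauss_mean (fun x => f x + g x) = gauss_mean f + gauss_mean g.
Proof. by move=> f0 bf g0 bg; rewrite /gauss_mean ge0_integralD. Qed.

Lemma gauss_mean_cst k (c : R) : gauss_mean (fun _ : 'cV[R]_k => c%:E) = c%:E.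
Proof. by rewrite /gauss_mean integral_cst //= probability_setT mule1. Qed.

End GaussianExpectation.

(** * The one-dimensional normal law *)

Section NormalLaw.
Context {R : realType}.
Notation TR := (measurableTypeR R).
Notation N01 := (normal_prob (0 : R) (1 : R)).
Notation leb := (@lebesgue_measure R).
Notation pdf := (normal_pdf (0 : R) (1 : R)).

Definition affine (a b : R) (x : TR) : TR := a * x + b.

Lemma measurable_affine a b : measurable_fun setT (affine a b).
Proof. by apply: measurable_funD => //; exact: measurable_funM. Qed.

Lemma lebesgue_measure_affine (a b : R) (A : set TR) : a != 0 -> measurable A ->
  (leb A = `|a|%:E * leb (affine a b @^-1` A))%E.
Proof.
move=> a0 mA; have maff := measurable_affine a b.
have -> : (`|a|%:E * leb (affine a b @^-1` A))%E =
    mscale (`|a|%:nng) (pushforward leb (affine a b)) A by [].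
apply: lebesgue_measure_unique mA => _ [[u v] _ <-] /=.
rewrite /mscale /= /pushforward.
have [ap|an] : 0 < a \/ a < 0 by apply/orP; rewrite -neq_lt eq_sym.
  have -> : affine a b @^-1` `]u, v] = `](u - b) / a, (v - b) / a]%classic.
    apply/seteqP; split=> x; rewrite /= !in_itv /= /affine ltr_pdivrMr // ler_pdivlMr //
      ltrBlDr lerBrDr [x * a]mulrC //.
  rewrite !lebesgue_measure_itv /= !lte_fin ltr_pM2r ?invr_gt0 // ltrD2r.
  case: ifP => _; last by rewrite mule0.
  by rewrite -!EFinD -EFinM gtr0_norm //; congr EFin; field.
have -> : affine a b @^-1` `]u, v] = `[(v - b) / a, (u - b) / a[%classic.
  apply/seteqP; split=> x; rewrite /= !in_itv /= /affine ltr_ndivlMr // ler_ndivrMr //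
    ltrBlDr lerBrDr [x * a]mulrC andbC //.
rewrite !lebesgue_measure_itv /= !lte_fin ltr_nM2r ?invr_lt0 // ltrD2r.
case: ifP => _; last by rewrite mule0.
by rewrite -!EFinD -EFinM ltr0_norm //; congr EFin; field.
Qed.

Local Open Scope ereal_scope.

(** Change of variable for an arbitrary measurable [f]: it holds for indicators by
    uniqueness of Lebesgue measure, and is transferred through the pushforward. *)
Lemma integral_affine (a b : R) (f : R -> \bar R) : (a != 0)%R ->
  measurable_fun setT f -> (forall x, 0 <= f x) ->
  `|a|%:E * \int[leb]_x f (a * x + b)%R = \int[leb]_x f x.
Proof.
move=> a0 mf f0.
have maff := measurable_affine a b.
rewrite [RHS](eq_measure_integral (mscale (`|a|%:nng)%R (pushforward leb (affine a b)))) //.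
  rewrite ge0_integral_mscale //=; congr (_ * _).
  by rewrite ge0_integral_pushforward.
by move=> A mA _; exact: lebesgue_measure_affine.
Qed.

(** Both sides are integrals against the Radon-Nikodym derivative, which agrees
    almost everywhere with the density. *)
Lemma integral_normal_prob (f : R -> \bar R) :
  measurable_fun setT f -> (forall x, 0 <= f x) ->
  \int[N01]_x f x = \int[leb]_x (f x * (pdf x)%:E).
Proof.
move=> mf f0.
have dom := @normal_prob_dominates R 0 1.
have mp : measurable_fun [set: R] (fun x => (pdf x)%:E).
  by apply/measurable_EFinP; exact: measurable_normal_pdf.
rewrite -(Radon_Nikodym_SigmaFinite.change_of_variables dom f0 measurableT mf).
have int := Radon_Nikodym_SigmaFinite.f_integrable dom.
apply: ae_eq_integral => //.
- by apply: emeasurable_funM => //; exact: measurable_int int.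
- exact: emeasurable_funM.
apply: ae_eqe_mul2l => /=; apply: integral_ae_eq => //= E _ mE.
by rewrite -Radon_Nikodym_SigmaFinite.f_integral.
Qed.

Lemma normal_pdf01E (x : R) :
  pdf x = (normal_peak 1 * expR (- x ^+ 2 / 2))%R.
Proof. by rewrite normal_pdfE ?oner_neq0 // /normal_fun subr0 expr1n. Qed.

Lemma normal_pdfN (x : R) : pdf (- x)%R = pdf x.
Proof. by rewrite !normal_pdf01E sqrrN. Qed.

Lemma integral_normal_probN (f : R -> \bar R) :
  measurable_fun setT f -> (forall x, 0 <= f x) ->
  \int[N01]_x f (- x)%R = \int[N01]_x f x.
Proof.
move=> mf f0; have mN : measurable_fun setT (fun x : R => f (- x)%R).
  exact: measurableT_comp.
rewrite !integral_normal_prob //.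
rewrite -(@integral_affine (-1) 0 (fun x => f x * (pdf x)%:E)); last 3 first.
- by rewrite oppr_eq0 oner_eq0.
- apply: emeasurable_funM => //; apply/measurable_EFinP; exact: measurable_normal_pdf.
- by move=> x; rewrite mule_ge0 // lee_fin normal_pdf_ge0.
rewrite normrN1 mul1e; apply: eq_integral => x _.
by rewrite mulN1r addr0 normal_pdfN.
Qed.

(** Integrate [1 + h x^2 <= exp (h x^2)]: multiplying the standard density by the
    right-hand side gives, for [h = (1 - s^-2) / 2], [s] times the density of
    standard deviation [s].  Hence [1 + h m <= s] for every [s > 1], and [s -> 1]
    gives [m <= 1]. *)
Lemma second_moment_normal_le1 : \int[N01]_x (x ^+ 2)%:E <= 1.
Proof.
set m := integral _ _ _.
have m0 : 0 <= m by apply: integral_ge0 => x _; rewrite lee_fin sqr_ge0.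
have H (s : R) : (1 < s)%R -> 1 + ((1 - s ^- 2) / 2)%:E * m <= s%:E.
  move=> s1; have s0 : (0 < s)%R by exact: lt_trans s1.
  set h := ((1 - s ^- 2) / 2)%R.
  have h0 : (0 <= h)%R.
    by rewrite divr_ge0 // subr_ge0 invf_le1 ?exprn_gt0 // exprn_ege1 // ltW.
  have mx2 : measurable_fun [set: R] (fun x : R => (x ^+ 2)%:E).
    by apply/measurable_EFinP; exact: measurable_funX.
  have mhx2 : measurable_fun [set: R] (fun x : R => h%:E * (x ^+ 2)%:E).
    exact: emeasurable_funM.
  have hx0 (x : R) : 0 <= h%:E * (x ^+ 2)%:E by rewrite -EFinM lee_fin mulr_ge0 ?sqr_ge0.
  have m1 : measurable_fun [set: R] (fun x : R => 1 + h%:E * (x ^+ 2)%:E).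
    exact: emeasurable_funD.
  have -> : 1 + h%:E * m = \int[N01]_x (1 + h%:E * (x ^+ 2)%:E).
    rewrite ge0_integralD //; congr (_ + _).
      by rewrite integral_cst //= probability_setT mule1.
    by rewrite ge0_integralZl // => x _; rewrite lee_fin sqr_ge0.
  rewrite integral_normal_prob //; last by move=> x; rewrite adde_ge0.
  have -> : s%:E = s%:E * \int[leb]_x (normal_pdf 0 s x)%:E.
    by rewrite integral_normal_pdf mule1.
  have mp (r : R) : measurable_fun [set: R] (fun x : R => (normal_pdf 0 r x)%:E).
    by apply/measurable_EFinP; exact: measurable_normal_pdf.
  have p0 (r x : R) : 0 <= (normal_pdf 0 r x)%:E by rewrite lee_fin normal_pdf_ge0.
  rewrite -(ge0_integralZl leb measurableT (mp s) (fun x _ => p0 s x)); last first.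
    by rewrite lee_fin ltW.
  apply: ge0_le_integral => //.
  - by move=> x _; rewrite mule_ge0 ?adde_ge0.
  - by apply: emeasurable_funM; [exact: m1|exact: mp].
  - by apply: emeasurable_funM => //; exact: mp.
  move=> x _; rewrite -!(EFinM, EFinD) lee_fin normal_pdf01E normal_pdfE ?gt_eqF //.
  rewrite /normal_fun subr0.
  have -> : (s * (normal_peak s * expR (- x ^+ 2 / (s ^+ 2 *+ 2))) =
             normal_peak 1 * expR (- x ^+ 2 / 2) * expR (h * x ^+ 2))%R.
    rewrite -mulrA -expRD mulrA; congr (_ * expR _)%R.
      rewrite /normal_peak expr1n mul1r -mulrnAr sqrtrM ?sqr_ge0 // sqrtr_sqr gtr0_norm //.
      by rewrite invfM mulrA divff ?gt_eqF // mul1r.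
    by rewrite /h -(mulr_natl (s ^+ 2)); field; rewrite gt_eqF.
  rewrite [leLHS]mulrC; apply: ler_wpM2l; last exact: expR_ge1Dx.
  by rewrite mulr_ge0 ?expR_ge0 // normal_peak_ge0.
case: m m0 H => [m|//|//] m0 H; last first.
  by have := H 2%R; rewrite ltr1n gt0_muley ?addey // => [/(_ isT)|]; rewrite // lte_fin; lra.
rewrite lee_fin leNgt; apply/negP => m1.
(* for s = 1 + e the bound reads m <= 2 s^2 / (s + 1), at most 1 + 5 e / 2 when e <= 1 *)
pose e := Num.min 1%R ((m - 1) / 5)%R.
have e0 : (0 < e)%R by rewrite lt_min ltr01 /= divr_gt0 // subr_gt0.
have e1 : (e <= 1)%R by rewrite ge_min lexx.
have e5 : (e <= (m - 1) / 5)%R by rewrite ge_min lexx orbT.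
have := H (1 + e)%R; rewrite ltrDl => /(_ e0); rewrite -EFinM -EFinD lee_fin.
have s0 : (0 < 1 + e)%R by lra.
have -> : (1 + (1 - (1 + e) ^- 2) / 2 * m =
  1 + e * (2 + e) * m / (2 * (1 + e) ^+ 2))%R by field; rewrite gt_eqF.
rewrite lerD2l ler_pdivrMr ?mulr_gt0 ?exprn_gt0 //.
rewrite -mulrA ler_pM2l // => H1; move: H1; nra.
Qed.

End NormalLaw.

(** * Rotation invariance in the plane *)

Section PlaneRotation.
Context {R : realType}.
Notation TR := (measurableTypeR R).
Notation N01 := (normal_prob (0 : R) (1 : R)).
Notation leb := (@lebesgue_measure R).
Notation pdf := (normal_pdf (0 : R) (1 : R)).
Local Open Scope ereal_scope.

Lemma measurable_lin (a b : R) :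
  measurable_fun setT (fun xy : TR * TR => a * xy.1 + b * xy.2 : TR)%R.
Proof. by apply: measurable_funD; apply: measurable_funM => //. Qed.

(** A rotation with [c != 0] factors as the two one-variable substitutions
    [u = c x + s y] at fixed [y], then [v = (y - s u) / c] at fixed [u], with
    jacobians [c] and [1 / c]; Tonelli exchanges the variables in between. *)
Lemma lebesgue_rotation (c s : R) (G : TR * TR -> \bar R) :
  (c != 0)%R -> (c ^+ 2 + s ^+ 2 = 1)%R ->
  measurable_fun setT G -> (forall z, 0 <= G z) ->
  \int[leb]_x \int[leb]_y G (c * x + s * y, - s * x + c * y)%R =
  \int[leb]_x \int[leb]_y G (x, y).
Proof.
move=> c0 cs mG G0.
have mrot (a b c' d : R) : measurable_fun setT
    (fun xy : TR * TR => G (a * xy.1 + b * xy.2, c' * xy.1 + d * xy.2)%R).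
  by apply: measurableT_comp => //; apply: measurable_fun_pair; exact: measurable_lin.
have mG1 (a b : R) : measurable_fun setT
    (fun xy : TR * TR => G (xy.1, a * xy.2 + b * xy.1)%R).
  apply: measurableT_comp => //; apply: measurable_fun_pair => //.
  by apply: measurable_funD; apply: measurable_funM.
have alg (x y : R) :
    (- s * x + c * y = c^-1 * y + - (s / c) * (c * x + s * y))%R.
  transitivity ((c ^+ 2 + s ^+ 2) / c * y + - (s / c) * (c * x + s * y))%R.
    by field.
  by rewrite cs div1r.
have cK u : u = (`|c|^-1)%:E * (`|c|%:E * u).
  by rewrite muleA -EFinM mulVf ?normr_eq0 // mul1e.
apply: (etrans (cK _)); apply: (etrans _ (esym (cK _))); congr (_ * _).
have -> : \int[leb]_x \int[leb]_y G (c * x + s * y, - s * x + c * y)%R =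
    \int[leb]_y \int[leb]_x G (c * x + s * y, - s * x + c * y)%R.
  exact: (@fubini_tonelli _ _ TR TR R leb leb _ (mrot c s (- s) c)%R (fun=> G0 _)).
rewrite -ge0_integralZl //=; last 2 first.
- exact: (@measurable_fun_fubini_tonelli_G _ _ TR TR R leb _ (mrot c s (- s) c)%R (fun=> G0 _)).
- by move=> y _; apply: integral_ge0.
transitivity (\int[leb]_y \int[leb]_u G (u, c^-1 * y + - (s / c) * u)%R).
  apply: eq_integral => y _.
  have my := measurable_fun_pair1 y (mG1 c^-1 (- (s / c)))%R.
  rewrite -(@integral_affine _ c (s * y) _ c0 my (fun=> G0 _)) /=.
  congr (_ * _); apply: eq_integral => x _; congr (G (_, _)).
  exact: alg.
transitivity (\int[leb]_u \int[leb]_y G (u, c^-1 * y + - (s / c) * u)%R).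
  exact/esym/(@fubini_tonelli _ _ TR TR R leb leb _ (mG1 c^-1 (- (s / c)))%R (fun=> G0 _)).
rewrite -ge0_integralZl //; last 2 first.
- exact: (@measurable_fun_fubini_tonelli_F _ _ TR TR R leb _ mG G0).
- by move=> y _; apply: integral_ge0.
apply: eq_integral => u _ /=.
have mu : measurable_fun setT (fun y : TR => G (u, y)) by exact: measurable_fun_pair2.
rewrite -(@integral_affine _ c^-1 (- (s / c) * u)%R (fun y => G (u, y))) ?invr_eq0 //.
by rewrite muleA -EFinM -normrM divff // normr1 mul1e.
Qed.

Lemma integral_normal2E (F : TR * TR -> \bar R) :
  measurable_fun setT F -> (forall z, 0 <= F z) ->
  \int[N01]_x \int[N01]_y F (x, y) =
  \int[leb]_x \int[leb]_y (F (x, y) * (pdf x * pdf y)%:E).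
Proof.
move=> mF F0.
have mp : measurable_fun [set: R] (fun x => (pdf x)%:E).
  by apply/measurable_EFinP; exact: measurable_normal_pdf.
have p0 x : 0 <= (pdf x)%:E by rewrite lee_fin normal_pdf_ge0.
rewrite integral_normal_prob; last 2 first.
- exact: (@measurable_fun_fubini_tonelli_F _ _ TR TR R N01 _ mF F0).
- by move=> x; apply: integral_ge0.
apply: eq_integral => x _.
have mx : measurable_fun setT (fun y : TR => F (x, y)) by exact: measurable_fun_pair2.
rewrite integral_normal_prob // -ge0_integralZr //; last 2 first.
- exact: emeasurable_funM.
- by move=> y _; rewrite mule_ge0.
by apply: eq_integral => y _; rewrite EFinM -muleA [(pdf y)%:E * _]muleC.
Qed.

(** The density of the product law depends on [x^2 + y^2] only, hence is invariant
    under the rotation. *)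
Lemma normal_rotation (c s : R) (F : TR * TR -> \bar R) :
  (c != 0)%R -> (c ^+ 2 + s ^+ 2 = 1)%R ->
  measurable_fun setT F -> (forall z, 0 <= F z) ->
  \int[N01]_x \int[N01]_y F (c * x + s * y, - s * x + c * y)%R =
  \int[N01]_x \int[N01]_y F (x, y).
Proof.
move=> c0 cs mF F0.
pose G (xy : TR * TR) := F xy * (pdf xy.1 * pdf xy.2)%:E.
have mG : measurable_fun setT G.
  apply: emeasurable_funM => //; apply/measurable_EFinP.
  by apply: measurable_funM; apply: measurableT_comp => //; exact: measurable_normal_pdf.
have G0 z : 0 <= G z by rewrite mule_ge0 // lee_fin mulr_ge0 ?normal_pdf_ge0.
rewrite (integral_normal2E mF F0) -(lebesgue_rotation c0 cs mG G0).
pose H (xy : TR * TR) := F (c * xy.1 + s * xy.2, - s * xy.1 + c * xy.2)%R.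
have mH : measurable_fun setT H.
  by apply: measurableT_comp => //; apply: measurable_fun_pair; exact: measurable_lin.
have H0 z : 0 <= H z by exact: F0.
apply: (etrans (integral_normal2E mH H0)).
apply: eq_integral => x _; apply: eq_integral => y _; rewrite /G /=.
congr (_ * _%:E); rewrite !normal_pdf01E.
rewrite mulrACA [RHS]mulrACA -!expRD; congr (_ * expR _)%R.
by rewrite -!mulrDl -!opprD -[X in (- X / _ = _)%R]mul1r -cs; congr (- _ / _)%R; ring.
Qed.

End PlaneRotation.

(** * Symmetries of the gaussian law *)

Section GaussianSymmetry.
Context {R : realType}.
Notation TR := (measurableTypeR R).
Notation N01 := (normal_prob (0 : R) (1 : R)).
Local Open Scope ereal_scope.

(** All orthogonal matrices have this property.  Stating it as a predicate lets it
    be propagated from plane rotations and sign changes through products,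
    transposition and the adjunction of a fixed coordinate. *)
Definition gaussian_symmetry k (Q : 'M[R]_k) : Prop :=
  (Q^T *m Q = 1%:M)%R /\
  forall f : 'cV[R]_k -> \bar R, (forall x, 0 <= f x) -> borel f ->
    gauss_mean (fun x => f (Q *m x)) = gauss_mean f.

Lemma gaussian_symmetry1 k : gaussian_symmetry (1%:M : 'M[R]_k).
Proof.
split=> [|f f0 bf]; first by rewrite trmx1 mulmx1.
by congr gauss_mean; apply/funext => x; rewrite mul1mx.
Qed.

Lemma gaussian_symmetryM k (P Q : 'M[R]_k) :
  gaussian_symmetry P -> gaussian_symmetry Q -> gaussian_symmetry (P *m Q).
Proof.
move=> [PP gP] [QQ gQ]; split=> [|f f0 bf].
  by rewrite trmx_mul mulmxA -(mulmxA Q^T) PP mulmx1.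
rewrite -(gP f) // -(gQ (fun x => f (P *m x))) //; last exact: borel_mulmx.
by congr gauss_mean; apply/funext => x; rewrite mulmxA.
Qed.

Lemma gaussian_symmetryT k (Q : 'M[R]_k) :
  gaussian_symmetry Q -> gaussian_symmetry Q^T.
Proof.
move=> [QQ gQ]; split=> [|f f0 bf]; first by rewrite trmxK; exact: mulmx1C.
rewrite -(gQ (fun x => f (Q^T *m x))) //; last exact: borel_mulmx.
by congr gauss_mean; apply/funext => x; rewrite mulmxA QQ mul1mx.
Qed.

Lemma gaussian_symmetry_lift k (Q : 'M[R]_k) : gaussian_symmetry Q ->
  gaussian_symmetry (block_mx 1%:M 0 0 Q : 'M[R]_(1 + k)).
Proof.
move=> [QQ gQ]; split=> [|f f0 bf].
  rewrite (tr_block_mx 1%:M) mulmx_block !trmx0 !trmx1 !mulmx0 !mul0mx !mulmx1.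
  by rewrite !addr0 add0r QQ -scalar_mx_block.
rewrite (gauss_meanS f0 bf) (gauss_meanS (fun=> f0 _) (borel_mulmx _ bf)).
apply: eq_integral => x _.
rewrite -(gQ (fun y => f (col_mx x%:M y))) //; last exact: borel_section.
by apply: eq_gauss_mean => y; rewrite mul_block_col !mul0mx mul1mx addr0 add0r.
Qed.

Definition flip_mx k : 'M[R]_(1 + k) := block_mx (- 1%:M) 0 0 1%:M.

Lemma flip_mxE k (x : R) (y : 'cV[R]_k) :
  (flip_mx k *m col_mx x%:M y = col_mx (- x)%:M y)%R.
Proof. by rewrite mul_block_col !mul0mx mulNmx !mul1mx addr0 add0r raddfN. Qed.

Lemma gaussian_symmetry_flip k : gaussian_symmetry (flip_mx k).
Proof.
split=> [|f f0 bf].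
  rewrite (tr_block_mx (- 1%:M)) mulmx_block !trmx0 linearN /= !trmx1 !mulmx0 !mul0mx.
  by rewrite !mulmx1 linearN /= trmx1 opprK !addr0 add0r -scalar_mx_block.
rewrite (gauss_meanS f0 bf) (gauss_meanS (fun=> f0 _) (borel_mulmx _ bf)).
rewrite -[RHS]integral_normal_probN; last 2 first.
- exact: measurable_gauss_mean_section.
- by move=> x; exact: gauss_mean_ge0.
apply: eq_integral => x _; apply: eq_gauss_mean => y.
by rewrite flip_mxE.
Qed.

(** Givens rotation of the first two coordinates. *)
Definition rot_mx k (c s : R) : 'M[R]_(1 + (1 + k)) :=
  block_mx c%:M (row_mx s%:M 0) (col_mx (- s)%:M 0) (block_mx c%:M 0 0 1%:M).

Lemma rot_mxE k (c s x y : R) (t : 'cV[R]_k) :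
  (rot_mx k c s *m col_mx x%:M (col_mx y%:M t) =
   col_mx (c * x + s * y)%:M (col_mx (- s * x + c * y)%:M t))%R.
Proof.
rewrite mul_block_col mul_row_col mul_col_mx mul_block_col !mul0mx mul1mx.
by rewrite add_col_mx !addr0 !add0r -!scalar_mxM -!raddfD.
Qed.

Lemma gaussian_symmetry_rot k (c s : R) : (c != 0)%R -> (c ^+ 2 + s ^+ 2 = 1)%R ->
  gaussian_symmetry (rot_mx k c s).
Proof.
move=> c0 cs; split=> [|f f0 bf].
  have -> : (rot_mx k c s)^T = rot_mx k c (- s).
    rewrite [LHS](tr_block_mx c%:M) tr_row_mx tr_col_mx (tr_block_mx c%:M).
    by rewrite !trmx0 trmx1 !tr_scalar_mx /rot_mx opprK.
  apply: eq_mulmx_col => x; rewrite -mulmxA mul1mx -[x]vsubmxK.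
  rewrite -[dsubmx x]vsubmxK [usubmx x]mx11_scalar [usubmx (dsubmx x)]mx11_scalar.
  move: (usubmx x 0%R 0%R) (usubmx (dsubmx x) 0%R 0%R) (dsubmx (dsubmx x)) => a b t.
  rewrite !rot_mxE; congr (col_mx _%:M (col_mx _%:M _)).
    by rewrite -[RHS]mul1r -cs; ring.
  by rewrite -[RHS]mul1r -cs; ring.
have mF : measurable_fun setT (fun xy : TR * TR =>
    gauss_mean (fun t : 'cV[R]_k => f (col_mx xy.1%:M (col_mx xy.2%:M t)))).
  pose h (z : (TR * TR) * k.-tuple TR) :=
    f (col_mx z.1.1%:M (col_mx z.1.2%:M (col_of_tuple z.2))).
  apply: (@measurable_fun_fubini_tonelli_F _ _ (TR * TR)%type (k.-tuple TR) R
    (gaussian k) h _ (fun=> f0 _)).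
  pose g (z : (TR * TR) * k.-tuple TR) : k.+2.-tuple TR :=
    [tuple of z.1.1 :: [tuple of z.1.2 :: z.2]].
  have -> : h = (fun t : k.+2.-tuple TR => f (col_of_tuple t)) \o g.
    by apply/funext => z; rewrite /h /g /= !col_of_tuple_cons.
  apply: measurableT_comp => //.
  apply: measurable_cons; first exact: measurableT_comp.
  by apply: measurable_cons => //; exact: measurableT_comp.
have E (h : 'cV[R]_(1 + (1 + k)) -> \bar R) : (forall x, 0 <= h x) -> borel h ->
   @gauss_mean R k.+2 h = \int[N01]_x \int[N01]_y
     gauss_mean (fun t : 'cV[R]_k => h (col_mx x%:M (col_mx y%:M t))).
  move=> h0 bh; rewrite gauss_meanS //; apply: eq_integral => x _.
  by rewrite gauss_meanS //; exact: borel_section.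
rewrite (E f f0 bf) (E _ (fun=> f0 _) (borel_mulmx _ bf)).
apply: (etrans _ (normal_rotation c0 cs mF (fun z => gauss_mean_ge0 (fun=> f0 _)))).
apply: eq_integral => x _; apply: eq_integral => y _.
by apply: eq_gauss_mean => t; rewrite rot_mxE.
Qed.

Local Close Scope ereal_scope.

(** Givens reduction: the tail is rotated by induction onto its first coordinate,
    which is then absorbed by a rotation of the first two coordinates. *)
Lemma reduce_column k (v : 'cV[R]_(1 + k)) :
  exists Q r, gaussian_symmetry Q /\ (Q *m v = col_mx r%:M 0)%R.
Proof.
elim: k => [|k IH] in v *.
  exists 1%:M, (v 0 0)%R; split; first exact: gaussian_symmetry1.
  rewrite mul1mx; apply/colP => i; rewrite !mxE; case: splitP => j; last by case: j.
  by rewrite !ord1 mxE.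
rewrite -[v]vsubmxK; set a := usubmx v; set w := dsubmx v.
have [Q [b [gQ Qw]]] := IH w.
suff [P [r [gP Pab]]] : exists P r, gaussian_symmetry P /\
    (P *m col_mx a (col_mx b%:M 0 : 'cV[R]_(1 + k)) = col_mx r%:M 0)%R.
  exists (P *m (block_mx 1%:M 0 0 Q : 'M[R]_(1 + (1 + k)))), r; split.
    by apply: gaussian_symmetryM => //; exact: gaussian_symmetry_lift.
  by rewrite -mulmxA mul_block_col !mul0mx mul1mx addr0 add0r Qw.
rewrite [a]mx11_scalar; move: (a 0 0)%R => {}a.
have col00 : col_mx 0%:M 0 = 0 :> 'cV[R]_(1 + k) by rewrite raddf0 col_mx0.
have [b0|b0] := eqVneq b 0%R.
  exists 1%:M, a; split; first exact: gaussian_symmetry1.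
  by rewrite mul1mx b0 col00.
have main (a' b' : R) : (a' != 0)%R -> exists P r, gaussian_symmetry P /\
    (P *m col_mx a'%:M (col_mx b'%:M 0 : 'cV[R]_(1 + k)) = col_mx r%:M 0)%R.
  move=> a0; pose r := Num.sqrt (a' ^+ 2 + b' ^+ 2).
  have r20 : (0 < a' ^+ 2 + b' ^+ 2)%R.
    by rewrite ltr_wpDr ?sqr_ge0 // lt_neqAle sqr_ge0 eq_sym sqrf_eq0 a0.
  have r2 : (r ^+ 2 = a' ^+ 2 + b' ^+ 2)%R by rewrite sqr_sqrtr // ltW.
  have r0 : r != 0%R by rewrite gt_eqF // sqrtr_gt0.
  exists (rot_mx k (a' / r) (b' / r)), r; split.
    apply: gaussian_symmetry_rot; first by rewrite mulf_neq0 ?invr_eq0.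
    by rewrite !exprMn -mulrDl -r2 -exprMn divff // expr1n.
  rewrite rot_mxE; have -> : (a' / r * a' + b' / r * b' = r)%R.
    by apply: (mulIf r0); rewrite -expr2 r2; field.
  by have -> : (- (b' / r) * a' + a' / r * b' = 0)%R by [ring|]; rewrite col00.
have [a0|] := eqVneq a 0%R; last exact: main.
(* the quarter turn has c = 0: a first rotation by (3/5, 4/5) moves away from it *)
have [P [r [gP Pr]]] := main (4 / 5 * b)%R (3 / 5 * b)%R
  ltac:(by rewrite mulf_neq0 // mulf_neq0 ?invr_eq0 ?pnatr_eq0).
exists (P *m rot_mx k (3 / 5) (4 / 5)), r; split.
  apply: gaussian_symmetryM => //; apply: gaussian_symmetry_rot; last by field.
  by rewrite mulf_neq0 ?invr_eq0 ?pnatr_eq0.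
by rewrite -mulmxA rot_mxE a0 !mulr0 !add0r Pr.
Qed.

End GaussianSymmetry.

(** * Comparison of gaussian means under a contraction *)

Section Comparison.
Context {R : realType}.
Notation TR := (measurableTypeR R).
Notation N01 := (normal_prob (0 : R) (1 : R)).

Definition convex_fun k (psi : 'cV[R]_k -> R) : Prop :=
  forall (t : R) x y, 0 <= t <= 1 ->
    psi (t *: x + (1 - t) *: y) <= t * psi x + (1 - t) * psi y.

Lemma convex_fun_mulmx m n (A : 'M[R]_(m, n)) psi :
  convex_fun psi -> convex_fun (fun x => psi (A *m x)).
Proof.
move=> cpsi t x y t01; rewrite mulmxDr -!scalemxAr; exact: cpsi.
Qed.

Lemma le_gauss_mean_section k (f g : 'cV[R]_(1 + k) -> \bar R) :
  (forall x, (0 <= f x)%E) -> borel f -> (forall x, (0 <= g x)%E) -> borel g ->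
  (forall x : R, (gauss_mean (fun y => f (col_mx x%:M y)) <=
                  gauss_mean (fun y => g (col_mx x%:M y)))%E) ->
  (@gauss_mean R k.+1 f <= @gauss_mean R k.+1 g)%E.
Proof.
move=> f0 bf g0 bg fg; rewrite (gauss_meanS f0 bf) (gauss_meanS g0 bg).
apply: ge0_le_integral => //.
- by move=> x _; exact: gauss_mean_ge0.
- exact: measurable_gauss_mean_section.
- exact: measurable_gauss_mean_section.
Qed.

(** One step of the singular value decomposition.  If [x] maximizes [|B x|] on the
    sphere, rotations sending [x] and [B x] to the first axis make the first column
    of [B] vanish below the diagonal, and maximality makes the first row vanish
    too: a nonzero entry would increase the norm to first order. *)
Lemma nsq_contraction_split n (B : 'M[R]_n.+1) :
  (forall x, nsq (B *m x) <= nsq x) ->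
  exists (P Q : 'M[R]_(1 + n)) (s : R) (C : 'M[R]_n),
    [/\ gaussian_symmetry P, gaussian_symmetry Q, s ^+ 2 <= 1,
        forall x, nsq (C *m x) <= nsq x
      & B = P *m block_mx s%:M 0 0 C *m Q].
Proof.
move=> cB; have [x x1 xmax] := norm_attained B.
have [Q1 [r1 [gQ1 Q1x]]] := @reduce_column R n x.
have [Q2 [r2 [gQ2 Q2x]]] := @reduce_column R n (B *m x).
have [orth1 _] := gQ1; have [orth2 _] := gQ2.
have orth1' := mulmx1C orth1.
have r1E : r1 ^+ 2 = 1.
  by rewrite -x1 -(nsq_orthogonal _ orth1) Q1x nsq_col_mx nsq0 addr0 nsq_scalar.
have r2E : r2 ^+ 2 = nsq (B *m x).
  by rewrite -(nsq_orthogonal _ orth2) Q2x nsq_col_mx nsq0 addr0 nsq_scalar.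
pose B' : 'M[R]_(1 + n) := Q2 *m B *m Q1^T.
have B'max y : nsq (B' *m y) <= r2 ^+ 2 * nsq y.
  rewrite /B' -!mulmxA nsq_orthogonal // r2E.
  have orth1T : Q1^T^T *m Q1^T = 1%:M by rewrite trmxK.
  by apply: le_trans (xmax _) _; rewrite (nsq_orthogonal y orth1T).
have B'e : B' *m col_mx r1%:M 0 = col_mx r2%:M 0.
  by rewrite -Q1x /B' -!mulmxA (mulmxA Q1^T) orth1 mul1mx.
pose s := r1 * r2.
have sE : s ^+ 2 = r2 ^+ 2 by rewrite exprMn r1E mul1r.
have BE := submxK B'.
move: (ulsubmx B') (ursubmx B') (dlsubmx B') (drsubmx B') BE => a u d C BE.
move: B'e; rewrite -BE mul_block_col !mulmx0 !addr0 => /eq_col_mx[ar1 dr1].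
have r1K : r1%:M *m r1%:M = 1%:M :> 'M[R]_1.
  by rewrite -scalar_mxM -expr2 r1E.
have as_ : a = s%:M.
  by rewrite -[a]mulmx1 -r1K mulmxA ar1 -scalar_mxM mulrC.
have d0 : d = 0 by rewrite -[d]mulmx1 -r1K mulmxA dr1 mul0mx.
have key (t : R) (y : 'cV[R]_n) :
    (s * t + (u *m y) 0 0) ^+ 2 + nsq (C *m y) <= s ^+ 2 * (t ^+ 2 + nsq y).
  have := B'max (col_mx t%:M y).
  rewrite -BE as_ d0 mul_block_col mul0mx add0r !nsq_col_mx nsq_scalar sE.
  by rewrite -scalar_mxM [u *m y]mx11_scalar -raddfD nsq_scalar !mxE.
have u0 : u = 0.
  apply: eq_mulmx_col => y; rewrite mul0mx [u *m y]mx11_scalar.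
  suff -> : (u *m y) 0 0 = 0 by rewrite raddf0.
  set b := (u *m y) 0 0; apply/eqP.
  have [s0|s0] := eqVneq s 0.
    have := key 0 y; rewrite -/b s0 mul0r expr0n add0r !mul0r => H.
    rewrite -sqrf_eq0 eq_le sqr_ge0 andbT.
    by apply: le_trans H; rewrite lerDl nsq_ge0.
  apply/negPn/negP => b0.
  (* b = <u, y>; this t makes the cross term 2 s t b cancel s^2 |y|^2 exactly *)
  have := key ((s ^+ 2 * nsq y) / (2 * s * b)) y; rewrite -/b => H.
  have b2 : 0 < b ^+ 2 by rewrite lt_neqAle sqr_ge0 eq_sym sqrf_eq0 b0.
  have := nsq_ge0 (C *m y); have := nsq_ge0 y; move: H.
  set N := nsq y; set M := nsq (C *m y) => H N0 M0.
  have {}H : b ^+ 2 + M <= 0.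
    rewrite -subr_ge0 in H; rewrite -subr_ge0; apply: le_trans H _.
    by rewrite le_eqVlt; apply/orP; left; apply/eqP; field; rewrite s0 b0.
  by move: H; rewrite leNgt => /negP; apply; rewrite ltr_wpDr.
exists Q2^T, Q1, s, C; split => //.
- exact: gaussian_symmetryT.
- by rewrite sE r2E -[leRHS]x1; exact: cB.
- move=> y; have := key 0 y.
  rewrite u0 mul0mx mxE mulr0 !expr0n addr0 expr0n !add0r => H.
  apply: le_trans H _; rewrite ler_piMl ?nsq_ge0 //.
  by rewrite sE r2E -[leRHS]x1; exact: cB.
rewrite -as_ -{1}d0 -u0 BE /B' !mulmxA orth2 mul1mx -!mulmxA orth1 mulmx1 //.
Qed.

(** A contraction is an average of orthogonal matrices, and the mean of [psi] is
    invariant under the latter, so convexity gives the bound.  The induction treats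
    one singular value [s] at a time: multiplication of a coordinate by [s] is the
    average of the identity and of a sign change with weights [(1 + s) / 2] and
    [(1 - s) / 2]. *)
Lemma gaussian_comparison n (B : 'M[R]_n) (psi : 'cV[R]_n -> R) :
  (forall x, nsq (B *m x) <= nsq x) -> (forall x, 0 <= psi x) ->
  borel (fun x => (psi x)%:E) -> convex_fun psi ->
  (gauss_mean (fun x => (psi (B *m x))%:E) <= gauss_mean (fun x => (psi x)%:E))%E.
Proof.
elim: n => [|n IH] in B psi *.
  by move=> _ _ _ _; rewrite le_eqVlt; apply/orP; left; apply/eqP/eq_gauss_mean => x;
    rewrite [B *m x]flatmx0 [x]flatmx0.
move=> /nsq_contraction_split[P [Q [s [C [gP gQ s1 cC ->]]]]] psi0 bpsi cpsi.
pose psi1 x := psi (P *m x).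
have psi10 x : 0 <= psi1 x by exact: psi0.
have psiE0 x : (0 <= (psi x)%:E)%E by rewrite lee_fin.
have psi1E0 x : (0 <= (psi1 x)%:E)%E by rewrite lee_fin.
have bpsi1 : borel (fun x => (psi1 x)%:E) by exact: (borel_mulmx P bpsi).
have cpsi1 : convex_fun psi1 by exact: convex_fun_mulmx.
pose D : 'M[R]_(1 + n) := block_mx s%:M 0 0 C.
pose E : 'M[R]_(1 + n) := block_mx s%:M 0 0 1%:M.
have blockE (X : 'M[R]_n) (x : R) y :
    block_mx s%:M 0 0 X *m col_mx x%:M y = col_mx (s * x)%:M (X *m y).
  by rewrite mul_block_col !mul0mx addr0 add0r -scalar_mxM.
have -> : gauss_mean (fun x => (psi (P *m D *m Q *m x))%:E) =
          gauss_mean (fun x => (psi1 (D *m x))%:E).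
  rewrite -(gQ.2 _ (fun=> psi1E0 _) (borel_mulmx D bpsi1)).
  by apply: eq_gauss_mean => x; rewrite /psi1 !mulmxA.
have -> : gauss_mean (fun x => (psi x)%:E) = gauss_mean (fun x => (psi1 x)%:E).
  exact/esym/(gP.2 _ psiE0 bpsi).
apply: (@le_trans _ _ (gauss_mean (fun x => (psi1 (E *m x))%:E))).
  apply: (le_gauss_mean_section (fun=> psi1E0 _) (borel_mulmx D bpsi1)
    (fun=> psi1E0 _) (borel_mulmx E bpsi1)).
  move=> x; pose psi2 y := psi1 (col_mx (s * x)%:M y).
  rewrite (@eq_gauss_mean _ _ _ (fun y => (psi2 (C *m y))%:E)); last by move=> y; rewrite blockE.
  rewrite [leRHS](@eq_gauss_mean _ _ _ (fun y => (psi2 y)%:E)); last first.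
    by move=> y; rewrite blockE mul1mx.
  apply: (IH C psi2 cC (fun=> psi10 _) (borel_section (s * x) bpsi1)).
  move=> t y z t01; rewrite /psi2.
  have -> : (col_mx (s * x)%:M (t *: y + (1 - t) *: z) : 'cV[R]_(1 + n)) =
     t *: col_mx (s * x)%:M y + (1 - t) *: col_mx (s * x)%:M z.
    by rewrite !scale_col_mx add_col_mx -scalerDl (addrC t) subrK scale1r.
  exact: cpsi1.
have /andP[sm1 sp1] : -1 <= s <= 1.
  by rewrite -ler_norml -(@ler_pXn2r _ 2) ?nnegrE // expr1n real_normK ?num_real.
have p0 : 0 <= (1 + s) / 2 by lra.
have m0 : 0 <= 1 - (1 + s) / 2 by lra.
have bF := borel_mulmx (flip_mx n) bpsi1.
apply: (@le_trans _ _ (gauss_mean (fun x => (((1 + s) / 2)%:E * (psi1 x)%:E +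
    (1 - (1 + s) / 2)%:E * (psi1 (flip_mx n *m x))%:E)%E))).
  apply: le_gauss_mean => //.
  - exact: (borel_mulmx E bpsi1).
  - by apply: emeasurable_funD; apply: emeasurable_funM.
  move=> x; rewrite -!EFinM -EFinD lee_fin.
  have -> : E *m x = ((1 + s) / 2) *: x + (1 - (1 + s) / 2) *: (flip_mx n *m x).
    rewrite -[x](@vsubmxK _ 1 n) [usubmx x]mx11_scalar blockE flip_mxE mul1mx.
    rewrite !scale_col_mx add_col_mx -[X in _ = col_mx _ X]scalerDl.
    rewrite (addrC ((1 + s) / 2)) subrK scale1r.
    by congr (col_mx _ _); rewrite !scale_scalar_mx -raddfD; congr _%:M; field.
  by apply: cpsi1; apply/andP; split; lra.
rewrite gauss_meanD //; last 4 first.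
- by move=> x; rewrite -EFinM lee_fin mulr_ge0.
- exact: emeasurable_funM.
- by move=> x; rewrite -EFinM lee_fin mulr_ge0.
- exact: emeasurable_funM.
rewrite !gauss_meanZl // ((gaussian_symmetry_flip n).2 _ psi1E0 bpsi1).
rewrite -ge0_muleDl ?lee_fin // -EFinD addrC subrK mul1e //.
Qed.

End Comparison.

(** * Mean squared distance to a set *)

Section SquaredDistanceMean.
Context {R : realType}.
Notation TR := (measurableTypeR R).
Notation N01 := (normal_prob (0 : R) (1 : R)).

(** An open set is a countable union of boxes with rational vertices. *)
Lemma measurable_open_tuple k (U : set 'cV[R]_k) : open U ->
  measurable [set t : k.-tuple TR | U (col_of_tuple t)].
Proof.
move=> oU.
pose box (q : {ffun 'I_k -> rat * rat}) : set 'cV[R]_k :=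
  [set x | forall i, (ratr (q i).1 < x i 0 < ratr (q i).2)].
have -> : [set t : k.-tuple TR | U (col_of_tuple t)] =
   \bigcup_(q : {ffun 'I_k -> rat * rat}) [set t | box q `<=` U /\ box q (col_of_tuple t)].
  apply/seteqP; split=> [t /= Ut|t [q _ [/= qU qt]]]; last exact: qU.
  have : nbhs (col_of_tuple t) U by apply: open_nbhs_nbhs.
  move=> /nbhs_ballP[e /= e0 eU].
  have H i : exists q : rat * rat, [/\ tnth t i - e < ratr q.1, ratr q.1 < tnth t i,
      tnth t i < ratr q.2 & ratr q.2 < tnth t i + e].
    have [a] := @rat_in_itvoo R (tnth t i - e) (tnth t i) ltac:(by rewrite gtrBl).
    rewrite in_itv /= => /andP[a1 a2].
    have [b] := @rat_in_itvoo R (tnth t i) (tnth t i + e) ltac:(by rewrite ltrDl).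
    rewrite in_itv /= => /andP[b1 b2].
    by exists (a, b).
  have [q Hq] := choice H.
  exists [ffun i => q i] => //; split=> [x xq|i /=]; last first.
    by rewrite ffunE mxE; have [_ -> ->] := Hq i.
  apply: eU; split => // i j; rewrite ord1 mxE.
  have := xq i; rewrite ffunE => /andP[x1 x2].
  have [q1 q2 q3 q4] := Hq i.
  rewrite /ball /= ltr_norml; apply/andP; split.
    by lra.
  by lra.
apply: countable_bigcupT_measurable => [|q]; first exact: countableP.
have [qU|nqU] := pselect (box q `<=` U); last first.
  by rewrite (_ : [set t | _] = set0) //; apply/seteqP; split=> t // [].
rewrite (_ : [set t | _] = \bigcap_(i : 'I_k)
    ((fun t : k.-tuple TR => tnth t i) @^-1` `]ratr (q i).1, ratr (q i).2[)).
  apply: fin_bigcap_measurable => // i _.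
  rewrite -[X in measurable X]setTI; apply: measurable_tnth => //.
apply/seteqP; split=> [t [_ /= bt] i _|t bt].
  by have := bt i; rewrite mxE /= in_itv.
by split => // i; have := bt i I; rewrite mxE /= in_itv.
Qed.

Lemma borel_sqdist k (S : set 'cV[R]_k) : S !=set0 ->
  borel (fun x => (sqdist S x)%:E).
Proof.
move=> S0; apply/measurable_EFinP.
apply: (measurability _ (RGenInftyO.measurableE R)) => _ [_ [c ->] <-].
rewrite setTI.
rewrite (_ : _ @^-1` _ = [set t : k.-tuple TR | [set x | sqdist S x < c] (col_of_tuple t)]).
  by apply: measurable_open_tuple; exact: open_sqdist_lt.
by apply/seteqP; split => t /=; rewrite in_itv.
Qed.

Lemma borel_nsq k : borel (fun x : 'cV[R]_k => (nsq x)%:E).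
Proof.
rewrite (_ : (fun _ => _) = fun x => (sqdist [set 0] x)%:E).
  by apply: borel_sqdist; exists 0.
by apply/funext => x; rewrite /sqdist image_set1 subr0 inf1.
Qed.

Definition mean_sqdist k (S : set 'cV[R]_k) : \bar R := gauss_mean (fun x => (sqdist S x)%:E).

Lemma gauss_mean_nsq k : (gauss_mean (fun x : 'cV[R]_k => (nsq x)%:E) <= k%:R%:E)%E.
Proof.
elim: k => [|k IH].
  rewrite (@eq_gauss_mean _ _ _ (fun=> 0%:E)) ?gauss_mean_cst // => x.
  by rewrite /nsq big_ord0.
have n0 m (x : 'cV[R]_m) : (0 <= (nsq x)%:E)%E by rewrite lee_fin nsq_ge0.
rewrite (gauss_meanS (n0 _) (@borel_nsq (1 + k))).
have mx2 : measurable_fun [set: R] (fun x : R => (x ^+ 2)%:E).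
  by apply/measurable_EFinP; exact: measurable_funX.
apply: (@le_trans _ _ (\int[N01]_x ((x ^+ 2)%:E + k%:R%:E))%E).
  apply: ge0_le_integral => //.
  - by move=> x _; exact: gauss_mean_ge0.
  - exact: (measurable_gauss_mean_section (n0 _) (@borel_nsq (1 + k))).
  - exact: emeasurable_funD.
  move=> x _.
  rewrite (@eq_gauss_mean _ _ _ (fun y => (x ^+ 2)%:E + (nsq y)%:E)%E); last first.
    by move=> y; rewrite nsq_col_mx nsq_scalar.
  rewrite gauss_meanD //; last exact: borel_nsq.
  - by rewrite gauss_mean_cst leeD2l.
  - by move=> _; rewrite lee_fin sqr_ge0.
  - exact: measurable_cst.
rewrite ge0_integralD //; last by move=> x _; rewrite lee_fin sqr_ge0.
rewrite integral_cst //= probability_setT mule1 -natr1 EFinD addeC.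
by rewrite leeD2r // second_moment_normal_le1.
Qed.

Lemma col_mx_cons n m (x : 'cV[R]_1) (u : 'cV[R]_n) (v : 'cV[R]_m) :
  (col_mx x (col_mx u v) : 'cV[R]_(1 + n + m)) = col_mx (col_mx x u) v.
Proof. by rewrite col_mxA castmx_id. Qed.

Lemma gauss_mean_nsq_fin k : exists M : R,
  gauss_mean (fun x : 'cV[R]_k => (nsq x)%:E) = M%:E /\ M <= k%:R.
Proof.
have := gauss_mean_nsq k.
have : (0 <= gauss_mean (fun x : 'cV[R]_k => (nsq x)%:E))%E.
  by apply: gauss_mean_ge0 => x; rewrite lee_fin nsq_ge0.
by case: (gauss_mean _) => [M|//|//] _; rewrite lee_fin => Mk; exists M.
Qed.

(** The blocks of a gaussian vector are independent; the second function is the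
    squared norm because it is what an orthogonal complement contributes to a
    squared distance. *)
Lemma gauss_mean_block_nsq n m (f : 'cV[R]_n -> R) :
  (forall x, 0 <= f x) -> borel (fun x => (f x)%:E) ->
  gauss_mean (fun z : 'cV[R]_(n + m) => (f (usubmx z) + nsq (dsubmx z))%:E) =
  (gauss_mean (fun x => (f x)%:E) + gauss_mean (fun y : 'cV[R]_m => (nsq y)%:E))%E.
Proof.
elim: n f => [|n IH] f f0 bf.
  rewrite (@eq_gauss_mean _ _ (fun x => (f x)%:E) (fun=> (f 0)%:E)); last first.
    by move=> x; rewrite [x]flatmx0.
  rewrite [LHS](@eq_gauss_mean _ _ _ (fun z : 'cV[R]_m => (f 0)%:E + (nsq z)%:E)%E); last first.
    move=> z; rewrite -EFinD [usubmx _]flatmx0; congr (_ + nsq _)%:E.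
    by apply/colP => i; rewrite mxE; congr (z _ _); exact/val_inj.
  rewrite gauss_meanD //; last exact: borel_nsq.
  - by rewrite !gauss_mean_cst.
  - by move=> _; rewrite lee_fin.
  - exact: measurable_cst.
  - by move=> x; rewrite lee_fin nsq_ge0.
pose F p (f : 'cV[R]_p -> R) (z : 'cV[R]_(p + m)) := (f (usubmx z) + nsq (dsubmx z))%:E.
have bF p (f' : 'cV[R]_p -> R) : borel (fun x => (f' x)%:E) -> borel (F p f').
  move=> bf'; rewrite (_ : F p f' = fun z => ((f' (usubmx 1%:M *m z))%:E +
     (nsq (dsubmx 1%:M *m z))%:E)%E).
    by apply: emeasurable_funD; [exact: (borel_mulmx _ bf')|exact: (borel_mulmx _ (@borel_nsq m))].
  by apply/funext => z; rewrite mul_usub_mx mul_dsub_mx mul1mx.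
have F0 p (f' : 'cV[R]_p -> R) : (forall x, 0 <= f' x) -> forall z, (0 <= F p f' z)%E.
  by move=> f'0 z; rewrite lee_fin addr_ge0 ?nsq_ge0.
rewrite [LHS](@gauss_meanS R (n + m) _ (F0 _ _ f0) (bF _ _ bf)) (gauss_meanS _ bf) //.
pose g (x : R) (y : 'cV[R]_n) : R := f (col_mx x%:M y : 'cV[R]_(1 + n)).
have bg x : borel (fun y => (g x y)%:E) by exact: (borel_section x bf).
have [M [ME _]] := gauss_mean_nsq_fin m.
transitivity (\int[N01]_x (gauss_mean (fun y => (g x y)%:E) + M%:E))%E.
  apply: eq_integral => x _; rewrite (@eq_gauss_mean _ _ _ (F n (g x))).
    by rewrite -ME; exact: (IH (g x) (fun=> f0 _) (bg x)).
  by move=> y; rewrite /F /g -[y in LHS]vsubmxK col_mx_cons col_mxKu col_mxKd.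
have M0 : (0 <= M%:E)%E by rewrite -ME; apply: gauss_mean_ge0 => y; rewrite lee_fin nsq_ge0.
rewrite ME ge0_integralD //.
- by rewrite integral_cst //= probability_setT mule1.
- by move=> x _; apply: gauss_mean_ge0 => y; rewrite lee_fin; exact: f0.
- by apply: (measurable_gauss_mean_section _ bf) => z; rewrite lee_fin.
Qed.

(** If [psi y] is the squared distance from [A^-1 y] to [S], then that of [x] to
    [S] is [psi (A x)]; after rescaling [A] to a contraction [B], the
    comparison lemma replaces [psi (B x)] by [psi x], and [b * psi] is at most the
    squared distance to the image of [S]. *)
Lemma mean_sqdist_mximage_le n (A : 'M[R]_n) (S : set 'cV[R]_n) (a b : R) :
  convex_cone S -> A \in unitmx -> 0 < a -> 0 <= b ->
  (forall x, nsq (A *m x) <= a * nsq x) ->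
  (forall x, b * nsq x <= nsq (A *m x)) ->
  (b%:E * mean_sqdist S <= a%:E * mean_sqdist (mximage A S))%E.
Proof.
move=> cS uA a0 b0 Aa Ab; have S0 : S !=set0 by case: cS.
pose psi y := sqdist S (invmx A *m y).
have bpsi : borel (fun y => (psi y)%:E).
  by apply: (borel_mulmx (invmx A) (borel_sqdist S0)).
have psi0 y : 0 <= psi y by exact: sqdist_ge0.
have cpsi : convex_fun psi.
  by apply: convex_fun_mulmx => t x y t01; exact: sqdist_convex.
have sa0 : 0 < Num.sqrt a by rewrite sqrtr_gt0.
have sa2 : Num.sqrt a ^+ 2 = a by rewrite sqr_sqrtr // ltW.
pose B := (Num.sqrt a)^-1 *: A.
have cB x : nsq (B *m x) <= nsq x.
  by rewrite -scalemxAl nsqZ exprVn sa2 ler_pdivrMl.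
have -> : mean_sqdist S = gauss_mean (fun x => a%:E * (psi (B *m x))%:E)%E.
  apply: eq_gauss_mean => x; rewrite -EFinM -sa2 -sqdistZ //; congr (sqdist _ _)%:E.
  by rewrite /B -scalemxAl -scalemxAr scalerA divff ?gt_eqF // scale1r mulKmx.
have bpsiB := borel_mulmx B bpsi.
have psiE0 x : (0 <= (psi x)%:E)%E by rewrite lee_fin.
rewrite (gauss_meanZl (ltW a0) (fun=> psiE0 _) bpsiB) muleCA.
apply: lee_wpmul2l; first by rewrite lee_fin ltW.
apply: (@le_trans _ _ (b%:E * gauss_mean (fun y => (psi y)%:E))%E).
  by apply: lee_wpmul2l; [rewrite lee_fin|exact: gaussian_comparison].
rewrite -(gauss_meanZl b0 psiE0 bpsi); apply: le_gauss_mean.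
- by move=> x; rewrite -EFinM lee_fin mulr_ge0.
- exact: emeasurable_funM.
- by apply: borel_sqdist; exact: mximage_neq0.
move=> x; rewrite -EFinM lee_fin /psi -{2}[x](mulKVmx uA).
exact: sqdist_mximage_ge.
Qed.

End SquaredDistanceMean.

(** * Projections and condition numbers *)

Section ConicProjection.
Context {R : realType}.

Lemma eproj_spec k (K : set 'cV[R]_k) x : closed K -> K !=set0 ->
  K (eproj K x) /\ forall z, K z -> nsq (x - eproj K x) <= nsq (x - z).
Proof.
move=> cK K0; have [y Ky ymin] := nearest_exists x cK K0.
have := @getPex _ [set y | K y /\ forall z, K z -> enorm (x - y) <= enorm (x - z)].
rewrite -/(eproj K x) => -[|Kp pmin].
  by exists y; split => // z Kz; rewrite le_enorm ymin.
by split => // z /pmin; rewrite le_enorm.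
Qed.

(** Minimality of the projection [y] along its own ray forces [<x - y, y> = 0], and
    Pythagoras concludes. *)
Lemma nsq_eproj k (K : set 'cV[R]_k) x : closed K -> K !=set0 ->
  (forall (a : R) y, 0 <= a -> K y -> K (a *: y)) ->
  nsq (eproj K x) = nsq x - sqdist K x.
Proof.
move=> cK K0 KZ; have [Ky ymin] := eproj_spec x cK K0.
move: (eproj K x) Ky ymin => y Ky ymin.
have -> : sqdist K x = nsq (x - y).
  by apply/eqP; rewrite eq_le sqdist_le // le_sqdist.
pose d := (x^T *m y) 0 0.
have H t : 0 <= t -> nsq y - 2 * d <= t ^+ 2 * nsq y - 2 * t * d.
  move=> t0; have := ymin _ (KZ t y t0 Ky).
  have dZ : (x^T *m (t *: y)) 0 0 = t * d by rewrite -scalemxAr mxE.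
  rewrite !nsqB nsqZ dZ -/d; lra.
suff E : d = nsq y by rewrite nsqB -/d E; ring.
have := nsq_ge0 y; rewrite le_eqVlt => /orP[|N0].
  rewrite eq_sym => /eqP Ny; move/eqP: (Ny); rewrite nsq_eq0 => /eqP y0.
  by rewrite /d Ny y0 mulmx0 mxE.
have d0 : 0 <= d by have := H 0 (lexx _); lra.
have := H (d / nsq y); rewrite divr_ge0 ?(ltW N0) // => /(_ isT).
have -> : (d / nsq y) ^+ 2 * nsq y - 2 * (d / nsq y) * d = - (d ^+ 2 / nsq y).
  by field; rewrite gt_eqF.
rewrite lerNr -(ler_pM2r N0) divfK ?gt_eqF // => H1.
have : (d - nsq y) ^+ 2 <= 0 by move: H1; lra.
by rewrite real_exprn_even_le0 //= ?num_real // subr_eq0 => /eqP.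
Qed.

Lemma mean_sqdist_fin k (S : set 'cV[R]_k) : convex_cone S ->
  exists d : R, mean_sqdist S = d%:E /\ 0 <= d.
Proof.
move=> cS; have S0 : S !=set0 by case: cS.
have [M [ME _]] := @gauss_mean_nsq_fin R k.
have h : (mean_sqdist S <= M%:E)%E.
  rewrite -ME; apply: le_gauss_mean; [|exact: borel_sqdist|exact: borel_nsq|].
    by move=> x; rewrite lee_fin sqdist_ge0.
  by move=> x; rewrite lee_fin sqdist_le_nsq.
have : (0 <= mean_sqdist S)%E by apply: gauss_mean_ge0 => x; rewrite lee_fin sqdist_ge0.
by move: h; case: (mean_sqdist S) => [d|//|//] _; rewrite lee_fin => d0; exists d.
Qed.

Lemma stat_dimE k (K : set 'cV[R]_k) (M d : R) : closed K -> K !=set0 ->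
  (forall (a : R) y, 0 <= a -> K y -> K (a *: y)) ->
  gauss_mean (fun x : 'cV[R]_k => (nsq x)%:E) = M%:E -> mean_sqdist K = d%:E ->
  stat_dim K = (M - d)%:E.
Proof.
move=> cK K0 KZ ME dE.
have -> : stat_dim K = gauss_mean (fun x => (nsq x - sqdist K x)%:E).
  rewrite /stat_dim unlock; apply: eq_integral => t _.
  by rewrite sqr_enorm nsq_eproj.
have bD : borel (fun x => (nsq x - sqdist K x)%:E).
  have /measurable_EFinP b1 := @borel_nsq R k.
  have /measurable_EFinP b2 := borel_sqdist K0.
  by apply/measurable_EFinP; exact: measurable_funB.
have D0 x : (0 <= (nsq x - sqdist K x)%:E)%E.
  by rewrite -nsq_eproj // lee_fin nsq_ge0.
have d0 x : (0 <= (sqdist K x)%:E)%E by rewrite lee_fin sqdist_ge0.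
have E : (gauss_mean (fun x => (nsq x - sqdist K x)%:E) + d%:E = M%:E)%E.
  rewrite -dE -(gauss_meanD D0 bD d0 (borel_sqdist K0)) -ME.
  by apply: eq_gauss_mean => x; rewrite -EFinD subrK.
by move: E; case: (gauss_mean _) => [r|//|//]; rewrite -EFinD => -[<-]; rewrite addrK.
Qed.

End ConicProjection.

Section ConditionNumber.
Context {R : realType}.

Lemma enorm0 k : enorm (0 : 'cV[R]_k) = 0.
Proof. by rewrite enormE nsq0 sqrtr0. Qed.

Lemma enorm_eq0 k (x : 'cV[R]_k) : (enorm x == 0) = (x == 0).
Proof. by rewrite -sqrf_eq0 sqr_enorm nsq_eq0. Qed.

Lemma enormZ k (a : R) (x : 'cV[R]_k) : enorm (a *: x) = `|a| * enorm x.
Proof. by rewrite !enormE nsqZ sqrtrM ?sqr_ge0 // sqrtr_sqr. Qed.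

Lemma dot_le_enorm k (x y : 'cV[R]_k) : (x^T *m y) 0 0 <= enorm x * enorm y.
Proof.
apply: le_trans (ler_norm _) _.
rewrite -(@ler_pXn2r _ 2) ?nnegrE ?mulr_ge0 ?enorm_ge0 //.
by rewrite exprMn !sqr_enorm real_normK ?num_real // cauchy_schwarz.
Qed.

Lemma enorm_normalize k (x : 'cV[R]_k) : x != 0 -> enorm ((enorm x)^-1 *: x) = 1.
Proof.
move=> x0; rewrite enormZ ger0_norm ?invr_ge0 ?enorm_ge0 // mulVf //.
by rewrite enorm_eq0.
Qed.

Lemma enorm_opnorm p n (A : 'M[R]_(p, n)) x : enorm (A *m x) <= opnorm A * enorm x.
Proof.
have [->|x0] := eqVneq x 0; first by rewrite mulmx0 !enorm0 mulr0.
have xp : 0 < enorm x by rewrite lt_neqAle eq_sym enorm_eq0 x0 enorm_ge0.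
rewrite -ler_pdivrMr // mulrC.
have -> : (enorm x)^-1 * enorm (A *m x) = enorm (A *m ((enorm x)^-1 *: x)).
  by rewrite -scalemxAr enormZ ger0_norm // invr_ge0 enorm_ge0.
apply: sup_ubound; last first.
  by exists ((enorm x)^-1 *: x) => //=; rewrite enorm_normalize.
case: n A x x0 xp => [|n] A x x0 xp; first by rewrite [x]flatmx0 eqxx in x0.
have [v v1 vmax] := norm_attained A.
exists (enorm (A *m v)) => _ [y /= y1 <-].
rewrite le_enorm; apply: le_trans (vmax y) _.
rewrite ler_piMr ?nsq_ge0 // -sqr_enorm exprn_ile1 ?enorm_ge0 //.
Qed.

Lemma sigma_min_enorm p n (A : 'M[R]_(p, n)) x :
  sigma_min A * enorm x <= enorm (A *m x).
Proof.
have [->|x0] := eqVneq x 0; first by rewrite mulmx0 !enorm0 mulr0.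
have xp : 0 < enorm x by rewrite lt_neqAle eq_sym enorm_eq0 x0 enorm_ge0.
rewrite -ler_pdivlMr // mulrC.
have -> : (enorm x)^-1 * enorm (A *m x) = enorm (A *m ((enorm x)^-1 *: x)).
  by rewrite -scalemxAr enormZ ger0_norm // invr_ge0 enorm_ge0.
apply: inf_lbound; last first.
  by exists ((enorm x)^-1 *: x) => //=; rewrite /esphere /= enorm_normalize.
by exists 0 => _ [y _ <-]; exact: enorm_ge0.
Qed.

Lemma sigma_min_ge0 p n (A : 'M[R]_(p, n)) : 0 <= sigma_min A.
Proof.
have [[z Sz]|/set0P/negP/negPn/eqP S0] := pselect (@esphere R n !=set0).
  apply: lb_le_inf; first by exists (enorm (A *m z)); exists z.
  by move=> _ [y _ <-]; exact: enorm_ge0.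
by rewrite /sigma_min S0 image_set0 inf0.
Qed.

Lemma sigma_min_neq0_sphere p n (A : 'M[R]_(p, n)) : sigma_min A != 0 ->
  exists x : 'cV[R]_n, enorm x = 1.
Proof.
move=> s0; apply: contrapT => H; move/eqP: s0; apply.
rewrite /sigma_min (_ : @esphere R n = set0) ?image_set0 ?inf0 //.
by apply/seteqP; split => x // x1; apply: H; exists x.
Qed.

Lemma opnorm_gt0 p n (A : 'M[R]_(p, n)) : A != 0 -> 0 < opnorm A.
Proof.
move=> A0; rewrite ltNge; apply/negP => op0; move/eqP: A0; apply.
apply: eq_mulmx_col => x; rewrite mul0mx; apply/eqP; rewrite -enorm_eq0.
rewrite eq_le enorm_ge0 andbT; apply: le_trans (enorm_opnorm A x) _.
by rewrite mulr_le0_ge0 // enorm_ge0.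
Qed.

Lemma sigma_min_neq0 p n (A : 'M[R]_(p, n)) : sigma_min A != 0 -> A != 0.
Proof.
move=> s0; have [x x1] := sigma_min_neq0_sphere s0.
apply: contra_neq s0 => A0; apply/eqP; rewrite eq_le sigma_min_ge0 andbT.
by have := sigma_min_enorm A x; rewrite A0 mul0mx enorm0 x1 mulr1.
Qed.

(** The extended-real definition is reduced to a real number: the inverse vanishes,
    or is [c / opnorm A] for a constant [c] bounding below [A] or its transpose. *)
Lemma kappa_inv p n (A : 'M[R]_(p, n)) : exists r : R, ((kappa A)^-1 = r%:E)%E /\
  (r = 0 \/ exists c, [/\ 0 < c, 0 < opnorm A, r = c / opnorm A
     & (forall x, c * enorm x <= enorm (A *m x)) \/
       (forall x, c * enorm x <= enorm (A^T *m x))]).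
Proof.
have quot (c : R) : 0 <= c -> (c != 0 -> 0 < opnorm A) ->
   (forall x, c * enorm x <= enorm (A *m x)) \/
       (forall x, c * enorm x <= enorm (A^T *m x)) ->
   exists r : R, ((quot_infty (opnorm A) c)^-1 = r%:E)%E /\
  (r = 0 \/ exists c, [/\ 0 < c, 0 < opnorm A, r = c / opnorm A
     & (forall x, c * enorm x <= enorm (A *m x)) \/
       (forall x, c * enorm x <= enorm (A^T *m x))]).
  move=> c0 cA H; rewrite /quot_infty; case: eqP => [_|/eqP c1].
    by exists 0; rewrite invey; split => //; left.
  have a0 := cA c1.
  exists (c / opnorm A); rewrite inver mulf_eq0 invr_eq0 (negPf c1) orbF gt_eqF //.
  rewrite invfM invrK mulrC; split => //; right; exists c; split => //.
  by rewrite lt_neqAle eq_sym c1.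
rewrite /kappa; case: (leP (quot_infty _ _) (quot_infty _ _)) => _.
  apply: quot; first exact: sigma_min_ge0.
    by move=> /sigma_min_neq0/opnorm_gt0.
  by left => x; exact: sigma_min_enorm.
apply: quot; first exact: sigma_min_ge0.
  by move=> /sigma_min_neq0 At0; apply: opnorm_gt0; rewrite -trmx_eq0.
by right => x; exact: sigma_min_enorm.
Qed.

Lemma mulmx_lb_row_free p n (A : 'M[R]_(p, n)) (c : R) : 0 < c ->
  (forall x, c * enorm x <= enorm (A^T *m x)) -> row_free A.
Proof.
move=> c0 cA; rewrite -kermx_eq0; apply/eqP/row_matrixP => i; rewrite row0.
have kA : row i (kermx A) *m A = 0 by rewrite -row_mul mulmx_ker row0.
apply: trmx_inj; rewrite trmx0; apply/eqP; rewrite -enorm_eq0.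
rewrite eq_le enorm_ge0 andbT -(pmulr_rle0 _ c0); apply: le_trans (cA _) _.
by rewrite -trmx_mul kA trmx0 enorm0.
Qed.

(** A matrix with at least as many rows as columns and an injective transpose is
    square, and then [|x|^2 = <A x, y>] with [A^T y = x] and [c |y| <= |x|]. *)
Lemma mulmx_lb_tr p n (A : 'M[R]_(p, n)) (c : R) : (n <= p)%N -> 0 < c ->
  (forall x, c * enorm x <= enorm (A^T *m x)) ->
  forall x, c * enorm x <= enorm (A *m x).
Proof.
move=> np c0 cA; have rA := mulmx_lb_row_free c0 cA.
have pn : p = n.
  by apply/eqP; rewrite eqn_leq np andbT -(eqP rA) rank_leq_col.
subst p => x; have uA : A \in unitmx by rewrite -row_free_unit.
have [->|x0] := eqVneq x 0; first by rewrite enorm0 mulr0 enorm_ge0.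
have xp : 0 < enorm x by rewrite lt_neqAle eq_sym enorm_eq0 x0 enorm_ge0.
pose y := (invmx A)^T *m x.
have Ay : A^T *m y = x by rewrite /y mulmxA -trmx_mul mulVmx // trmx1 mul1mx.
have := cA y; rewrite Ay => cy.
rewrite -(ler_pM2r xp) -mulrA -expr2 sqr_enorm nsq_dot -{2}Ay mulmxA -trmx_mul.
apply: le_trans (ler_wpM2l (ltW c0) (dot_le_enorm (A *m x) y)) _.
by rewrite mulrCA ler_wpM2l // enorm_ge0.
Qed.

Lemma mulmx_lb_unit n (A : 'M[R]_n) (c : R) : 0 < c ->
  (forall x, c * enorm x <= enorm (A *m x)) -> A \in unitmx.
Proof.
move=> c0 cA; rewrite -unitmx_tr -row_free_unit.
by apply: (mulmx_lb_row_free c0) => x; rewrite trmxK.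
Qed.

Lemma le_opnorm_lb p n (A : 'M[R]_(p, n)) (c : R) : 0 < opnorm A ->
  (forall x, c * enorm x <= enorm (A *m x)) -> c <= opnorm A.
Proof.
move=> a0 cA.
have [x x0] : exists x : 'cV[R]_n, x != 0.
  apply: contrapT => H; suff A0 : A = 0.
    have : opnorm A <= 0.
      apply: sup_le_ub; first by exists 0, 0; rewrite /= ?enorm0 // mulmx0 enorm0.
      by move=> _ [y _ <-]; rewrite A0 mul0mx enorm0.
    by rewrite leNgt a0.
  apply: eq_mulmx_col => x; suff -> : x = 0 by rewrite !mulmx0.
  by apply: contrapT => /eqP x0; apply: H; exists x.
have xp : 0 < enorm x by rewrite lt_neqAle eq_sym enorm_eq0 x0 enorm_ge0.
by rewrite -(ler_pM2r xp); apply: le_trans (cA x) (enorm_opnorm A x).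
Qed.

End ConditionNumber.

(** * Images and preimages of cones *)

Section Cones.
Context {R : realType}.

Lemma closed_convex_cone_convex_cone k (K : set 'cV[R]_k) :
  closed_convex_cone K -> convex_cone K.
Proof.
case=> K0 _ cK KZ; split => // x y Kx Ky.
have h0 : 0 <= 2^-1 :> R by lra.
have h1 : 2^-1 <= 1 :> R by lra.
have := cK x y (Itv01 h0 h1) (mem_set Kx) (mem_set Ky).
rewrite inE /conv /= => H.
have -> : x + y = 2 *: (2^-1 *: x + (1 - 2^-1) *: y).
  rewrite scalerDr !scalerA; congr (_ + _); rewrite -[LHS]scale1r; congr (_ *: _); lra.
by apply: KZ.
Qed.

Lemma convex_cone_preimage p n (D : 'M[R]_(p, n)) (K : set 'cV[R]_p) :
  convex_cone K -> convex_cone [set y | K (D *m y)].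
Proof.
move=> cK; have [K0 KD KZ] := cK; split.
- by exists 0 => /=; rewrite mulmx0; exact: convex_cone0.
- by move=> x y /=; rewrite mulmxDr; exact: KD.
- by move=> a x a0 /=; rewrite -scalemxAr; exact: KZ.
Qed.

Lemma descent_cone_mulmx p n (D : 'M[R]_(p, n)) (g : 'cV[R]_p -> \bar R) x0 :
  descent_cone (fun x => g (D *m x)) x0 = [set y | descent_cone g (D *m x0) (D *m y)].
Proof.
apply/seteqP; split=> y [t t0 /= gt]; exists t => //=.
  by rewrite scalemxAr -mulmxDr.
by rewrite mulmxDr -scalemxAr.
Qed.

(** For steps [s] and [t] admissible for [y] and [z], the point with step
    [s t / (s + t)] along [y + z] lies on the segment between the two. *)
Lemma convex_cone_descent k (f : 'cV[R]_k -> \bar R) x0 :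
  proper_convex f -> convex_cone (descent_cone f x0).
Proof.
case=> fNy _ fconv.
have D0 : descent_cone f x0 0 by exists 1 => //=; rewrite scaler0 addr0.
split; first by exists 0.
  move=> y z [s s0 /= fy] [t t0 /= fz].
  have st0 : 0 < s + t by rewrite addr_gt0.
  pose l := t / (s + t).
  have l0 : 0 <= l by rewrite divr_ge0 // ltW.
  have l1 : 0 <= 1 - l.
    by rewrite subr_ge0 ler_pdivrMr // mul1r lerDr ltW.
  exists (s * t / (s + t)); first by rewrite /= divr_gt0 // mulr_gt0.
  rewrite /=.
  have -> : x0 + (s * t / (s + t)) *: (y + z) =
      l *: (x0 + s *: y) + (1 - l) *: (x0 + t *: z).
    rewrite !scalerDr !scalerA addrACA -scalerDl (addrC l) subrK scale1r.
    by congr (_ + (_ *: _ + _ *: _)); rewrite /l; field; rewrite gt_eqF.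
  case E : (f x0) => [r| |]; last 2 first.
  - exact: leey.
  - by have := fNy x0; rewrite E.
  apply: le_trans (fconv _ _ l _) _; first by rewrite l0 -subr_ge0.
  apply: (@le_trans _ _ (l%:E * r%:E + (1 - l)%:E * r%:E)%E).
    by apply: leeD; apply: lee_wpmul2l; rewrite ?lee_fin // -E.
  by rewrite -!EFinM -EFinD lee_fin -mulrDl (addrC l) subrK mul1r.
move=> a y a0 [t t0 /= fy]; have [->|an0] := eqVneq a 0; first by rewrite scale0r.
have ap : 0 < a by rewrite lt_neqAle eq_sym an0.
by exists (t / a) => /=; [rewrite divr_gt0|rewrite scalerA divfK].
Qed.

Lemma closed_mximage n (A : 'M[R]_n) (C : set 'cV[R]_n) :
  A \in unitmx -> closed C -> closed (mximage A C).
Proof.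
move=> uA cC; have -> : mximage A C = (fun x => invmx A *m x) @^-1` C.
  apply/seteqP; split=> [_ [x Cx <-]|x Cx]; first by rewrite /= mulKmx.
  by exists (invmx A *m x); rewrite ?mulKVmx.
by apply: closed_comp cC => x _; exact: continuous_mulmx.
Qed.

Lemma mximage_mulmx m n p (A : 'M[R]_(m, n)) (B : 'M[R]_(n, p)) S :
  mximage A (mximage B S) = mximage (A *m B) S.
Proof.
apply/seteqP; split=> [_ [_ [x Sx <-] <-]|_ [x Sx <-]].
  by exists x; rewrite // mulmxA.
by exists (B *m x); rewrite ?mulmxA //; exists x.
Qed.

(** QR decomposition, one column at a time. *)
Lemma reduce_columns n m (D : 'M[R]_(n + m, n)) :
  exists2 Q, gaussian_symmetry Q & dsubmx (Q *m D) = 0.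
Proof.
elim: n D => [|n IH] D.
  by exists 1%:M; [exact: gaussian_symmetry1|apply/matrixP => i []].
have [Q1 [r [gQ1 Q1l]]] := @reduce_column R (n + m) (lsubmx (D : 'M[R]_(1 + (n + m), 1 + n))).
pose D1 : 'M[R]_(1 + (n + m), 1 + n) := Q1 *m D.
have [Q2 gQ2 Q2D] := IH (drsubmx D1).
exists ((block_mx 1%:M 0 0 Q2 : 'M[R]_(1 + (n + m))) *m Q1).
  by apply: gaussian_symmetryM => //; exact: gaussian_symmetry_lift.
rewrite -mulmxA -[Q1 *m D]/D1.
have ll : dlsubmx D1 = 0.
  have : lsubmx D1 = col_mx r%:M 0 by rewrite -Q1l /D1 -mulmx_lsub.
  have -> : dlsubmx D1 = dsubmx (lsubmx D1) by apply/matrixP => i j; rewrite !mxE.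
  by move=> ->; rewrite col_mxKd.
have D1E : (block_mx 1%:M 0 0 Q2 : 'M[R]_(1 + (n + m))) *m D1 =
    block_mx (ulsubmx D1) (ursubmx D1) 0 (Q2 *m drsubmx D1).
  rewrite -{1}[D1]submxK ll mulmx_block.
  by rewrite !mul0mx !mulmx0 !mul1mx !addr0 !add0r.
apply: (etrans (congr1 (fun X : 'M[R]_(n.+1 + m, n.+1) => dsubmx X) D1E)).
apply/matrixP => i j; rewrite mxE [RHS]mxE.
have -> : rshift n.+1 i = rshift 1 (rshift n i) :> 'I_(1 + (n + m)) by exact/val_inj.
case: (split_ordP (j : 'I_(1 + n))) => j' ->.
  by apply: (etrans (block_mxEdl _ _ _ _ (rshift n i) j')); rewrite mxE.
apply: (etrans (block_mxEdr _ _ _ _ (rshift n i) j')).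
by have /matrixP/(_ i j') := Q2D; rewrite !mxE.
Qed.

Lemma mulr_le_enorm k m (x : 'cV[R]_k) (y : 'cV[R]_m) (c : R) : 0 <= c ->
  (c * enorm x <= enorm y) = (c ^+ 2 * nsq x <= nsq y).
Proof.
move=> c0; rewrite -(@ler_pXn2r _ 2) ?nnegrE ?mulr_ge0 ?enorm_ge0 //.
by rewrite exprMn !sqr_enorm.
Qed.

Lemma enorm_le_mulr k m (x : 'cV[R]_k) (y : 'cV[R]_m) (c : R) : 0 <= c ->
  (enorm y <= c * enorm x) = (nsq y <= c ^+ 2 * nsq x).
Proof.
move=> c0; rewrite -(@ler_pXn2r _ 2) ?nnegrE ?mulr_ge0 ?enorm_ge0 //.
by rewrite exprMn !sqr_enorm.
Qed.

Lemma mean_sqdist_mximage_ge n (A : 'M[R]_n) (S : set 'cV[R]_n) (a c : R) :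
  convex_cone S -> 0 < a -> 0 < c ->
  (forall x, enorm (A *m x) <= a * enorm x) ->
  (forall x, c * enorm x <= enorm (A *m x)) ->
  (((c / a) ^+ 2)%:E * mean_sqdist S <= mean_sqdist (mximage A S))%E.
Proof.
move=> cS a0 c0 Aa Ac; have uA := mulmx_lb_unit c0 Ac.
have a20 : 0 < a ^+ 2 by rewrite exprn_gt0.
have [d [dE _]] := mean_sqdist_fin cS.
have [e [eE _]] := mean_sqdist_fin (convex_cone_mximage A cS).
have : ((c ^+ 2)%:E * mean_sqdist S <= (a ^+ 2)%:E * mean_sqdist (mximage A S))%E.
  apply: mean_sqdist_mximage_le => //; first by rewrite sqr_ge0.
    by move=> x; rewrite -enorm_le_mulr // ltW.
  by move=> x; rewrite -mulr_le_enorm // ltW.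
rewrite dE eE -!EFinM !lee_fin expr_div_n => H.
by rewrite mulrAC ler_pdivrMr // [e * _]mulrC.
Qed.

(** [mean_sqdist_mximage_ge] for the inverse matrix, whose bounds are [1 / c] and [1 / a]. *)
Lemma mean_sqdist_mximage_inv n (A : 'M[R]_n) (S : set 'cV[R]_n) (a c : R) :
  convex_cone S -> 0 < a -> 0 < c ->
  (forall x, enorm (A *m x) <= a * enorm x) ->
  (forall x, c * enorm x <= enorm (A *m x)) ->
  (((c / a) ^+ 2)%:E * mean_sqdist (mximage A S) <= mean_sqdist S)%E.
Proof.
move=> cS a0 c0 Aa Ac; have uA := mulmx_lb_unit c0 Ac.
have -> : c / a = a^-1 / c^-1 by rewrite invrK mulrC.
rewrite -[S in leRHS](_ : mximage (invmx A) (mximage A S) = S); last first.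
  rewrite mximage_mulmx mulVmx //; apply/seteqP; split=> [_ [x Sx <-]|x Sx].
    by rewrite mul1mx.
  by exists x; rewrite ?mul1mx.
apply: mean_sqdist_mximage_ge; rewrite ?invr_gt0 //; first exact: convex_cone_mximage.
  move=> x; rewrite ler_pdivlMl //; apply: le_trans (Ac _) _.
  by rewrite mulKVmx.
move=> x; rewrite ler_pdivrMl //; apply: le_trans (Aa _).
by rewrite mulKVmx.
Qed.

(** With [C] the preimage of [K], the image of [C] lies in [K], so it is at least as
    far away.  Rotating the range of [D] onto the first [n] coordinates, the squared
    distance to that image is the one inside the range plus the squared norm of the
    [p - n] remaining coordinates. *)
Lemma mean_sqdist_preimage p n (D : 'M[R]_(p, n)) (K : set 'cV[R]_p) (c : R) (dK dC Mp Mn : R) :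
  (n <= p)%N -> convex_cone K -> 0 < opnorm D -> 0 < c ->
  (forall x, c * enorm x <= enorm (D *m x)) ->
  mean_sqdist K = dK%:E -> mean_sqdist [set y | K (D *m y)] = dC%:E ->
  gauss_mean (fun x : 'cV[R]_p => (nsq x)%:E) = Mp%:E ->
  gauss_mean (fun x : 'cV[R]_n => (nsq x)%:E) = Mn%:E ->
  (c / opnorm D) ^+ 2 * dK <= (c / opnorm D) ^+ 2 * (Mp - Mn) + dC.
Proof.
move=> np cK a0 c0 Dc dKE dCE MpE MnE.
move: (p - n)%N (subnKC np) => m Ep; subst p.
have [Q [QQ gQ] QD] := reduce_columns D.
pose A := usubmx (Q *m D).
have QDE : Q *m D = col_mx A 0 by rewrite -QD vsubmxK.
have nA x : enorm (A *m x) = enorm (D *m x).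
  rewrite !enormE -(nsq_orthogonal (D *m x) QQ) mulmxA QDE mul_col_mx mul0mx.
  by rewrite nsq_col_mx nsq0 addr0.
have [Mm [MmE _]] := @gauss_mean_nsq_fin R m.
have n0 k (x : 'cV[R]_k) : (0 <= (nsq x)%:E)%E by rewrite lee_fin nsq_ge0.
have MpD : Mp = Mn + Mm.
  have := @gauss_mean_block_nsq R n m (@nsq R n) (@nsq_ge0 R n) (@borel_nsq R n).
  rewrite MnE MmE -EFinD -[X in _ = X -> _]/((Mn + Mm)%:E) => H.
  suff : Mp%:E = (Mn + Mm)%:E by case.
  rewrite -MpE -H; apply: eq_gauss_mean => z; by rewrite -nsq_col_mx vsubmxK.
pose C := [set y | K (D *m y)].
have cC : convex_cone C by exact: convex_cone_preimage.
have C0 : C !=set0 by case: cC.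
have DC0 : mximage D C !=set0 by exact: mximage_neq0.
have AC0 : mximage A C !=set0 by exact: mximage_neq0.
have [e [eE _]] := mean_sqdist_fin (convex_cone_mximage A cC).
have le1 : dK <= e + Mm.
  rewrite -lee_fin EFinD -dKE -eE -MmE -gauss_mean_block_nsq; last 2 first.
  - by move=> x; exact: sqdist_ge0.
  - exact: borel_sqdist.
  apply: (@le_trans _ _ (gauss_mean (fun x => (sqdist (mximage D C) x)%:E))).
    apply: le_gauss_mean; [|apply: borel_sqdist; by case: cK|exact: borel_sqdist|].
      by move=> x; rewrite lee_fin sqdist_ge0.
    move=> x; rewrite lee_fin; apply: sqdist_subset => //.
    by move=> _ [y Cy <-].
  have QDC0 : mximage Q (mximage D C) !=set0 by exact: mximage_neq0.
  rewrite le_eqVlt; apply/orP; left; apply/eqP.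
  transitivity (gauss_mean (fun x => (sqdist (mximage Q (mximage D C)) (Q *m x))%:E)).
    by apply: eq_gauss_mean => x; rewrite sqdist_orthogonal.
  rewrite (gQ (fun x => (sqdist (mximage Q (mximage D C)) x)%:E)); last 2 first.
  - by move=> x; rewrite lee_fin sqdist_ge0.
  - exact: borel_sqdist.
  apply: eq_gauss_mean => z; rewrite -[z in LHS]vsubmxK mximage_mulmx QDE.
  rewrite -sqdist_col_mx //; congr (sqdist _ _)%:E.
  apply/seteqP; split=> [_ [y Cy <-]|_ [_ [y Cy <-] <-]].
    by exists (A *m y); [exists y|rewrite mul_col_mx mul0mx].
  by exists y; rewrite // mul_col_mx mul0mx.
have : (((c / opnorm D) ^+ 2)%:E * mean_sqdist (mximage A C) <= mean_sqdist C)%E.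
  apply: mean_sqdist_mximage_inv => // x; rewrite nA //.
  exact: enorm_opnorm.
rewrite eE dCE -EFinM lee_fin => le2.
have r20 : 0 <= (c / opnorm D) ^+ 2 by exact: sqr_ge0.
have := ler_wpM2l r20 le1; rewrite MpD; move: le2; lra.
Qed.

End Cones.

Theorem corollaryI4 (R : realType) :
  (forall (n : nat) (C : set 'cV[R]_n) (A : 'M[R]_n),
     closed_convex_cone C -> A \in unitmx ->
     (stat_dim (mximage A C) <=
        (kappa A)^-1 ^+ 2 * stat_dim C
        + (1 - (kappa A)^-1 ^+ 2) * n%:R%:E)%E) /\
  (forall (p n : nat) (D : 'M[R]_(p, n)) (g : 'cV[R]_p -> \bar R)
          (x0 : 'cV[R]_n),
     (n <= p)%N -> proper_convex g ->
     (stat_dim_at (fun x : 'cV[R]_n => g (D *m x)) x0 <=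
        (kappa D)^-1 ^+ 2 * stat_dim_at g (D *m x0)
        + (1 - (kappa D)^-1 ^+ 2) * n%:R%:E)%E).
Proof.
split=> [n C A ccC uA|p n D g x0 np cg].
  have cC := closed_convex_cone_convex_cone ccC; have [_ clC _ _] := ccC.
  have cAC := convex_cone_mximage A cC.
  have [M [ME Mn]] := @gauss_mean_nsq_fin R n.
  have [d [dE d0]] := mean_sqdist_fin cC; have [e [eE e0]] := mean_sqdist_fin cAC.
  have [C0 _ CZ] := cC; have [AC0 _ ACZ] := cAC.
  rewrite (stat_dimE clC C0 CZ ME dE) (stat_dimE (closed_mximage uA clC) AC0 ACZ ME eE).
  have [r [-> rE]] := kappa_inv A.
  rewrite -EFin_expe -EFinM -EFinB -EFinM -EFinD lee_fin.
  case: rE => [->|[c [c0 a0 rE cA]]].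
    by rewrite expr0n /= mul0r add0r subr0 mul1r lerBlDr; lra.
  have {}cA x : c * enorm x <= enorm (A *m x).
    by case: cA => cA; [exact: cA|exact: (mulmx_lb_tr (leqnn n) c0 cA)].
  have := mean_sqdist_mximage_ge cC a0 c0 (enorm_opnorm A) cA.
  rewrite -rE dE eE -EFinM lee_fin => H.
  have r1 : 0 <= 1 - r ^+ 2.
    rewrite subr_ge0 rE exprn_ile1 ?divr_ge0 ?(ltW c0) ?(ltW a0) //.
    by rewrite ler_pdivrMr // mul1r le_opnorm_lb.
  have := ler_wpM2l r1 Mn; move: H; lra.
rewrite /stat_dim_at descent_cone_mulmx.
set K := descent_cone g (D *m x0); set C := [set y | K (D *m y)].
have cK : convex_cone K by exact: convex_cone_descent.
have cC : convex_cone C by exact: convex_cone_preimage.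
have [M [ME Mn]] := @gauss_mean_nsq_fin R n; have [Mp [MpE _]] := @gauss_mean_nsq_fin R p.
have [d [dE d0]] := mean_sqdist_fin cK; have [e [eE e0]] := mean_sqdist_fin cC.
have statE k (S : set 'cV[R]_k) (N b : R) : convex_cone S ->
    gauss_mean (fun x : 'cV[R]_k => (nsq x)%:E) = N%:E -> mean_sqdist S = b%:E ->
    stat_dim (closure S) = (N - b)%:E.
  move=> cS NE bE; have [S0 _ _] := cS.
  have bE' : mean_sqdist (closure S) = b%:E.
    by rewrite -bE; apply: eq_gauss_mean => x; rewrite sqdist_closure.
  apply: (stat_dimE (@closed_closure _ S) _ (convex_cone_closureZ cS) NE bE').
  by case: S0 => z Sz; exists z; exact: subset_closure.
rewrite (statE _ _ _ _ cK MpE dE) (statE _ _ _ _ cC ME eE).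
have [r [-> rE]] := kappa_inv D.
rewrite -EFin_expe -EFinM -EFinB -EFinM -EFinD lee_fin.
case: rE => [->|[c [c0 a0 rE cD]]].
  by rewrite expr0n /= mul0r add0r subr0 mul1r lerBlDr; lra.
have {}cD x : c * enorm x <= enorm (D *m x).
  by case: cD => cD; [exact: cD|exact: (mulmx_lb_tr np c0 cD)].
have := mean_sqdist_preimage np cK a0 c0 cD dE eE MpE ME; rewrite -rE => H.
have r1 : 0 <= 1 - r ^+ 2.
  rewrite subr_ge0 rE exprn_ile1 ?divr_ge0 ?(ltW c0) ?(ltW a0) //.
  by rewrite ler_pdivrMr // mul1r le_opnorm_lb.
have := ler_wpM2l r1 Mn; move: H; lra.
Qed.
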